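(* Let $p$ be a prime and let $d>2$. Let $G$ be the group generated by $\{\tau,U',V'\}$ subject to the following relations. Then $G$ is isomorphic to $\mathrm{SL}(d,p)$. (i) Defining relations for $\langle U',V'\rangle$ as the group of signed permutations of $\{1,\dots,d\}$ generated by $U',V'$ if $p$ is odd, or as unsigned permutations if $p=2$. (ii) Relations that present $\mathrm{SL}(2,p)$ on $\{\tau,U'\}$. (iii) If $d>3$ then $[\tau,U'^{V'^2}]=1$, and if $d>4$ then $[\tau,V'U'^{-1}(U'^{-1})^{V'}]=1$. (iv) (a) $[\tau,\tau^{V'}]=\tau^{U'^{V'}}$; (b) $[\tau,\tau^{U'^{V'}}]=1$; (c) $[\tau,\tau^{U'V'}]=1$; (d) if $d>3$ then $[\tau,\tau^{V'^2}]=1$.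
   Context: Conventions: $x^y=y^{-1}xy$, $[x,y]=x^{-1}y^{-1}xy$. Linear maps act on the right and fix unmentioned basis vectors. Generators of the presented group are denoted by the same symbols as the corresponding matrices. ''Relations that present (defining relations for) a group on given elements $g_1,\dots,g_k$'' means any set of relators in the free group on $k$ letters whose normal closure is the kernel of the natural map onto $\langle g_1,\dots,g_k\rangle$. Matrices: $e_1,\dots,e_d$ is a basis of the natural module over $\mathrm{GF}(p)$, $\tau=(e_1\mapsto e_1+e_2)$, $U'=(e_1\mapsto e_2,\ e_2\mapsto-e_1)$, $V'=(e_i\mapsto e_{i+1}\ (i<d),\ e_d\mapsto(-1)^{d+1}e_1)$. The matrices $U',V'$ give the signed ($p$ odd) or unsigned ($p=2$) permutations in (i). In (ii), $\mathrm{SL}(2,p)$ is identified with $\langle\tau,U'\rangle$ acting on $\langle e_1,e_2\rangle$, i.e. $\tau\mapsto\begin{pmatrix}1&1\\0&1\end{pmatrix}$, $U'\mapsto\begin{pmatrix}0&1\\-1&0\end{pmatrix}$. *)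

(* Defs.v *)
From HB Require Import structures.
From mathcomp Require Import all_boot all_order all_fingroup all_algebra.
From mathcomp Require Import boolp classical_sets.

Set Implicit Arguments.
Unset Strict Implicit.
Unset Printing Implicit Defensive.

Import GroupScope GRing.Theory.
Local Open Scope quotient_scope.
Local Open Scope classical_set_scope.
Local Open Scope group_scope.

(* The free group on T: reduced words in the letters (x, true), standing for  *)
(* x, and (x, false), standing for x^-1.                                      *)
Section FreeGroup.
Variable T : choiceType.
Implicit Types (a b : T * bool) (s w : seq (T * bool)).

Definition letter_inv a := (a.1, ~~ a.2).

Definition reduced w := sorted (fun a b => b != letter_inv a) w.

Definition free_cons a s :=
  if s is b :: s' then if b == letter_inv a then s' else a :: s else [:: a].

Lemma letter_invK : involutive letter_inv.
Proof. by case=> x b; rewrite /letter_inv /= negbK. Qed.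

Lemma reduced_cons a s : reduced s -> reduced (free_cons a s).
Proof.
case: s => [|b s] //= bs; case: eqP => [_|/eqP ne]; last by rewrite /= ne.
by case: s bs => [|c s] //= /andP[].
Qed.

Lemma reduced_cat w s : reduced s -> reduced (foldr free_cons s w).
Proof. by move=> ?; elim: w => //= a w; exact: reduced_cons. Qed.

Lemma free_consK a s :
  reduced s -> free_cons a (free_cons (letter_inv a) s) = s.
Proof.
case: s => [|b s] /=; first by rewrite eqxx.
rewrite letter_invK; case: eqP => [->|_] bs /=; last by rewrite eqxx.
by case: s bs => [|c s] //= /andP[/negPf->].
Qed.

Lemma free_consA a s u : reduced s -> reduced u ->
  foldr free_cons u (free_cons a s) = free_cons a (foldr free_cons u s).
Proof.
case: s => [|b s] //= bs ru; case: eqP => [->|//].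
by rewrite free_consK ?reduced_cat.
Qed.

Lemma free_catA s u w : reduced s -> reduced u ->
  foldr free_cons u (foldr free_cons s w) =
  foldr free_cons (foldr free_cons u s) w.
Proof.
by move=> rs ru; elim: w => //= a w <-; rewrite free_consA ?reduced_cat.
Qed.

Lemma free_cats0 w : reduced w -> foldr free_cons [::] w = w.
Proof.
elim: w => //= a w IHw aw; rewrite IHw; last exact: path_sorted aw.
by case: w aw {IHw} => //= b w /andP[/negPf->].
Qed.

Definition word_inv w := rev (map letter_inv w).

Lemma reduced_inv w : reduced w -> reduced (word_inv w).
Proof.
rewrite /reduced /word_inv rev_sorted sorted_map; apply: sub_sorted => a b /=.
by rewrite letter_invK; apply: contra => /eqP->.
Qed.

Lemma free_catV w s :
  reduced s -> foldr free_cons (foldr free_cons s w) (word_inv w) = s.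
Proof.
elim: w s => [|a w IHw] //= s rs.
rewrite /word_inv /= rev_cons foldr_rcons -/(word_inv w).
by rewrite -{2}[a]letter_invK free_consK ?reduced_cat ?IHw.
Qed.

Lemma word_invK : involutive word_inv.
Proof.
by move=> w; rewrite /word_inv map_rev revK -map_comp map_id_in // => a _ /=;
   rewrite letter_invK.
Qed.

Record freeGroup := FreeGroup {free_word :> seq (T * bool); _ : reduced free_word}.

HB.instance Definition _ := [isSub for free_word].
HB.instance Definition _ := [Choice of freeGroup by <:].

Definition free_one : freeGroup := @FreeGroup [::] isT.
Definition free_mul (x y : freeGroup) : freeGroup :=
  FreeGroup (reduced_cat x (valP y)).
Definition free_inv (x : freeGroup) : freeGroup :=
  FreeGroup (reduced_inv (valP x)).

Lemma free_mulA : associative free_mul.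
Proof.
by move=> x y z; apply: val_inj; rewrite /= free_catA // ?(valP y) ?(valP z).
Qed.

Lemma free_mul1 : left_id free_one free_mul.
Proof. by move=> x; apply: val_inj. Qed.

Lemma free_mulr1 : right_id free_one free_mul.
Proof. by move=> x; apply: val_inj; rewrite /= free_cats0 ?(valP x). Qed.

Lemma free_mulV : left_inverse free_one free_inv free_mul.
Proof.
move=> x; apply: val_inj => /=.
by rewrite -{1}(free_cats0 (valP x)) free_catV.
Qed.

Lemma free_mulrV : right_inverse free_one free_inv free_mul.
Proof.
move=> x; rewrite -{1}(_ : free_inv (free_inv x) = x) ?free_mulV //.
by apply: val_inj; rewrite /= word_invK.
Qed.

HB.instance Definition _ := isGroup.Build freeGroup
  free_mulA free_mul1 free_mulr1 free_mulV free_mulrV.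

Definition fgen (x : T) : freeGroup := @FreeGroup [:: (x, true)] isT.

Section Eval.
Variables (gT : groupType) (g : T -> gT).

Definition letter_eval a : gT := if a.2 then g a.1 else (g a.1)^-1.

Definition free_eval (x : freeGroup) : gT := \prod_(a <- x) letter_eval a.

Lemma free_eval_is_mul : {morph free_eval : x y / x * y}.
Proof.
move=> x y; rewrite /free_eval /=; elim: (free_word x) => [|a s IHs] /=.
  by rewrite big_nil mul1g.
rewrite big_cons -mulgA -{}IHs.
case: (foldr _ _ s) => [|b w] /=; first by rewrite big_seq1 big_nil mulg1.
case: eqP => [->|_]; rewrite !big_cons //.
by case: a => t [] /=; rewrite /letter_eval /= ?mulKVg ?mulKg.
Qed.

Lemma free_eval1 : free_eval 1 = 1.
Proof. by rewrite /free_eval big_nil. Qed.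

HB.instance Definition _ := isUMagmaMorphism.Build freeGroup gT free_eval
  (free_eval1, free_eval_is_mul).

Lemma free_eval_gen x : free_eval (fgen x) = g x.
Proof. by rewrite /free_eval big_seq1. Qed.

End Eval.
End FreeGroup.

Definition normal_subgroup (G : groupType) (N : set G) : Prop :=
  [/\ N 1,
      forall x y, N x -> N y -> N (x * y),
      forall x, N x -> N x^-1 &
      forall x y, N x -> N (x ^ y)].

Definition nclosure (G : groupType) (R : set G) : set G :=
  smallest (@normal_subgroup G) R.

Lemma nclosure_normal (G : groupType) (R : set G) :
  normal_subgroup (nclosure R).
Proof.
split=> [|x y xR yR|x xR|x y xR] N [nN RN]; have [N1 NM NV NJ] := nN => //.
- by apply: NM; [exact: xR | exact: yR].
- by apply: NV; exact: xR.
- by apply: NJ; exact: xR.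
Qed.

Section QuotientGroup.
Variables (G : groupType) (N : set G) (nN : normal_subgroup N).

Definition ncong (x y : G) : bool := `[< N (x^-1 * y) >].

Lemma ncong_refl : reflexive ncong.
Proof. by move=> x; apply/asboolP; rewrite mulVg; case: nN. Qed.

Lemma ncong_sym : symmetric ncong.
Proof.
have sym x y : ncong x y -> ncong y x.
  move=> /asboolP Nxy; apply/asboolP; have [_ _ NV _] := nN.
  by rewrite -[y^-1 * x]invgK invgM invgK; exact: NV.
by move=> x y; apply/idP/idP; exact: sym.
Qed.

Lemma ncong_trans : transitive ncong.
Proof.
move=> y x z /asboolP Nxy /asboolP Nyz; apply/asboolP; have [_ NM _ _] := nN.
by rewrite -[z](mulKVg y) mulgA; exact: NM.
Qed.

Definition ncong_equiv := EquivRel ncong ncong_refl ncong_sym ncong_trans.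

Definition quotGroup := {eq_quot ncong_equiv}.
HB.instance Definition _ := Choice.on quotGroup.
HB.instance Definition _ := EqQuotient.on quotGroup.

Local Notation repr := (@generic_quotient.repr _ quotGroup).

Definition quot_one : quotGroup := \pi_quotGroup 1.
Definition quot_mul (x y : quotGroup) : quotGroup :=
  \pi_quotGroup (repr x * repr y).
Definition quot_inv (x : quotGroup) : quotGroup := \pi_quotGroup (repr x)^-1.

Lemma pi_quotP x y : \pi_quotGroup x = \pi_quotGroup y <-> N (x^-1 * y).
Proof.
by split=> [/(@eqmodP _ ncong_equiv)/asboolP | /asboolP Nxy] //;
   apply/(@eqmodP _ ncong_equiv).
Qed.

Lemma ncong_repr x : N ((repr (\pi_quotGroup x))^-1 * x).
Proof. by apply/pi_quotP; rewrite reprK. Qed.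

Lemma ncong_mul x y x' y' :
  N (x^-1 * x') -> N (y^-1 * y') -> N ((x * y)^-1 * (x' * y')).
Proof.
move=> Nx Ny; have [_ NM _ NJ] := nN.
rewrite (_ : _ * _ = (x^-1 * x') ^ y * (y^-1 * y')); first exact/NM/Ny/NJ.
by rewrite /conjg invgM !mulgA mulgK.
Qed.

Lemma pi_quotM x y :
  \pi_quotGroup (x * y) = quot_mul (\pi_quotGroup x) (\pi_quotGroup y).
Proof. by apply/esym/pi_quotP/ncong_mul; exact: ncong_repr. Qed.

Lemma pi_quotV x : \pi_quotGroup x^-1 = quot_inv (\pi_quotGroup x).
Proof.
apply/esym/pi_quotP; have [_ _ NV NJ] := nN.
have := NV _ (NJ _ (repr (\pi_quotGroup x))^-1 (ncong_repr x)).
by rewrite /conjg !invgM !invgK !mulgA mulgK.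
Qed.

Lemma quot_mulA : associative quot_mul.
Proof.
move=> x y z; rewrite -[x]reprK -[y]reprK -[z]reprK.
rewrite -(pi_quotM (repr y)) -(pi_quotM (repr x) (repr y)).
by rewrite -(pi_quotM (repr x)) -(pi_quotM (repr x * repr y)) mulgA.
Qed.

Lemma quot_mul1 : left_id quot_one quot_mul.
Proof. by move=> x; rewrite -[x]reprK -pi_quotM mul1g. Qed.

Lemma quot_mulr1 : right_id quot_one quot_mul.
Proof. by move=> x; rewrite -[x]reprK -pi_quotM mulg1. Qed.

Lemma quot_mulV : left_inverse quot_one quot_inv quot_mul.
Proof. by move=> x; rewrite -[x]reprK -pi_quotV -pi_quotM mulVg. Qed.

Lemma quot_mulrV : right_inverse quot_one quot_inv quot_mul.
Proof. by move=> x; rewrite -[x]reprK -pi_quotV -pi_quotM mulgV. Qed.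

HB.instance Definition _ := isGroup.Build quotGroup
  quot_mulA quot_mul1 quot_mulr1 quot_mulV quot_mulrV.

End QuotientGroup.

Definition presentedGroup (T : choiceType) (R : set (freeGroup T)) :=
  quotGroup (nclosure_normal R).
HB.instance Definition _ (T : choiceType) (R : set (freeGroup T)) :=
  Group.on (presentedGroup R).

Definition presents (k : nat) (gT : groupType) (R : set (freeGroup 'I_k))
    (g : k.-tuple gT) : Prop :=
  nclosure R = [set w | free_eval (tnth g) w = 1].

Definition group_isomorphic (G H : groupType) : Prop :=
  exists f : {multiplicative G -> H}, bijective f.

Section SpecialLinear.
Variables (n : nat) (R : finComUnitRingType).

Definition SLgroup : {set {'GL_n[R]}} :=
  [set A : {'GL_n[R]} | (\det (GLval A) == 1)%R]%SET.

Lemma SLgroup_set : group_set SLgroup.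
Proof.
apply/group_setP; split=> [|A B]; first by rewrite inE GL_1E det1.
by rewrite !inE GL_MxE det_mulmx => /eqP-> /eqP->; rewrite mul1r.
Qed.

Canonical SLgroup_group := Group SLgroup_set.

End SpecialLinear.

(* Matrices act on row vectors from the right, so that row i of a matrix is   *)
(* the image of the i-th basis vector. Rows and columns are numbered from 0:  *)
(* the basis vector called e_k on paper is 'e_(k-1) here.                     *)
Section Matrices.
Variables (p d : nat).
Local Open Scope ring_scope.
Local Notation "''e_' i" := (delta_mx 0 i : 'rV['F_p]_d.-1.+1)
  (at level 8, i at level 2, format "''e_' i").

Definition tau_mx : 'M['F_p]_d.-1.+1 :=
  \matrix_(i < d.-1.+1)
    match nat_of_ord i with
    | 0 => 'e_ord0 + 'e_(inord 1)
    | _ => 'e_i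
    end.

Definition U_mx : 'M['F_p]_d.-1.+1 :=
  \matrix_(i < d.-1.+1)
    match nat_of_ord i with
    | 0 => 'e_(inord 1)
    | 1 => - 'e_ord0
    | _ => 'e_i
    end.

Definition V_mx : 'M['F_p]_d.-1.+1 :=
  \matrix_(i < d.-1.+1)
    if i == ord_max then (-1) ^+ d.+1 *: 'e_ord0 else 'e_(inord i.+1).

Lemma det_tau_mx : (1 < d)%N -> \det tau_mx = 1.
Proof.
move=> d_gt1; have d1 : (1 < d.-1.+1)%N by rewrite prednK // ltnW.
have tauE i j : tau_mx i j = if i == 0%N :> nat
    then (j == 0%N :> nat)%:R + (j == 1%N :> nat)%:R else (i == j)%:R.
  rewrite mxE; case: i => [[|i] /= lt_i]; rewrite !mxE /= -?val_eqE /=.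
    by rewrite inordK.
  by rewrite eq_sym.
rewrite -det_tr det_trig; last first.
  apply/is_trig_mxP => i j lt_ij; rewrite mxE tauE -val_eqE /=.
  by rewrite (gtn_eqF lt_ij); case: (nat_of_ord j) lt_ij.
apply: big1 => i _; rewrite mxE tauE eqxx.
by case: eqP => // ->; rewrite addr0.
Qed.

Lemma det_U_mx : (1 < d)%N -> \det U_mx = 1.
Proof.
move=> d_gt1; have d1 : (1 < d.-1.+1)%N by rewrite prednK // ltnW.
pose o1 : 'I_d.-1.+1 := inord 1; have o1E : o1 = 1%N :> nat by rewrite inordK.
have n01 : ord0 != o1 by rewrite -val_eqE /= o1E.
have dg : xrow ord0 o1 U_mx =
    \matrix_(i, j) ((-1) ^+ (i == ord0) *+ (i == j)).
  apply/matrixP => i j; rewrite !mxE; case: tpermP => [->|->|/eqP i0 /eqP i1].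
  - by rewrite o1E /= !mxE eqxx /= [j == _]eq_sym expr1 mulNrn.
  - by rewrite /= !mxE eqxx /= [j == _]eq_sym [o1 == _]eq_sym (negPf n01).
  rewrite (negPf i0) -val_eqE /= in i1 *; move: i0 i1; rewrite -!val_eqE /= o1E.
  by case: i => [[|[|i]] lt_i] // _ _; rewrite !mxE eqxx [j == _]eq_sym.
have: \det (xrow ord0 o1 U_mx) = -1.
  rewrite dg det_trig; last first.
    by apply/is_trig_mxP => i j lt_ij; rewrite mxE -!val_eqE /= (ltn_eqF lt_ij).
  rewrite (bigD1 ord0) //= big1 => [|i /negPf i0]; last first.
    by rewrite mxE i0 eqxx.
  by rewrite mxE !eqxx mulr1.
rewrite xrowE det_mulmx det_perm odd_tperm n01 expr1 mulN1r => /oppr_inj.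
by [].
Qed.

Lemma det_V_mx : (1 < d)%N -> \det V_mx = 1.
Proof.
move=> d_gt1; rewrite (expand_det_col _ ord0) (bigD1 ord_max) //= big1; last first.
  move=> i; rewrite -val_eqE /= => ni; rewrite !mxE -val_eqE /= (negPf ni) mxE.
  rewrite -!val_eqE /= inordK ?mul0r // ltnS ltn_neqAle ni /=.
  by rewrite -ltnS ltn_ord.
rewrite addr0 !mxE eqxx !mxE !eqxx mulr1 /cofactor addn0.
have ->: row' ord_max (col' ord0 V_mx) = 1%:M.
  apply/matrixP => i j; rewrite !mxE -!val_eqE /= /bump.
  rewrite leqNgt ltn_ord /= add0n (ltn_eqF (ltn_ord i)) mxE.
  by rewrite -!val_eqE /= inordK /= ?add1n ?eqSS 1?eq_sym // ltnS.
rewrite det1 mulr1 -exprD -signr_odd oddD /=.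
by case: (d) d_gt1 => //= n _; case: odd.
Qed.

Lemma det1_unitmx (A : 'M['F_p]_d.-1.+1) : \det A = 1 -> A \is a GRing.unit.
Proof.
by move=> dA; suff: A \in unitmx by []; rewrite unitmxE dA unitr1.
Qed.

Hypothesis d_gt1 : (1 < d)%N.

Definition tau : {'GL_d(p)} := Sub tau_mx (det1_unitmx (det_tau_mx d_gt1)).
Definition U' : {'GL_d(p)} := Sub U_mx (det1_unitmx (det_U_mx d_gt1)).
Definition V' : {'GL_d(p)} := Sub V_mx (det1_unitmx (det_V_mx d_gt1)).

End Matrices.

(* The generators tau, U', V' of the abstract group are the letters 0, 1, 2   *)
(* respectively; a relation x = y is encoded by the relator x * y^-1.         *)
Section Relators.
Variables (d : nat) (R1 R2 : set (freeGroup 'I_2)).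

Let t : freeGroup 'I_3 := fgen (inord 0).
Let u : freeGroup 'I_3 := fgen (inord 1).
Let v : freeGroup 'I_3 := fgen (inord 2).

Definition relators_i : set (freeGroup 'I_3) :=
  free_eval (tnth [tuple u; v]) @` R1.

Definition relators_ii : set (freeGroup 'I_3) :=
  free_eval (tnth [tuple t; u]) @` R2.

Definition relators_iii : set (freeGroup 'I_3) :=
  [set r | (3 < d)%N /\ r = [~ t, u ^ (v ^+ 2)]] `|`
  [set r | (4 < d)%N /\ r = [~ t, v * u^-1 * (u^-1) ^ v]].

Definition relators_iv : set (freeGroup 'I_3) :=
  [set [~ t, t ^ v] * (t ^ (u ^ v))^-1] `|`
  [set [~ t, t ^ (u ^ v)]] `|`
  [set [~ t, t ^ (u * v)]] `|`
  [set r | (3 < d)%N /\ r = [~ t, t ^ (v ^+ 2)]].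

Definition relators : set (freeGroup 'I_3) :=
  relators_i `|` relators_ii `|` relators_iii `|` relators_iv.

End Relators.

(* Main.v *)
Require Import Defs.
From HB Require Import structures.
From mathcomp Require Import all_boot all_order all_fingroup all_algebra.
From mathcomp Require Import boolp classical_sets.
From mathcomp Require Import ring.

(** The presented group G maps onto SL(d, p), because the relations hold for
    the matrices; the substance of the theorem is that this map is injective.

    Signed permutations come first. By (i), every identity between words in
    U' and V' that holds for matrices holds in G. The matrices of <U', V'>
    fixing the first two basis vectors are products of the adjacent signed
    transpositions e_k -> e_(k+1) -> -e_k with k > 2 ([signed_ind]); these are
    obtained from the first of them by conjugating with V'U'^-1(U'^-1)^V', so
    (iii) says that they commute with tau ([T_comm_fix]). Since (U')^2 also
    commutes with tau, by (ii), a conjugate of tau under a word f in U' and V'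
    depends only on the images of the first two basis vectors under f, up to a
    common sign ([Tconj_eq], [Tconj_eqN]). It is therefore attached to an
    ordered pair of distinct signed basis vectors, as a transvection is, and G
    has at most two such elements for each root (i, j).

    Changing one of the two signs should invert the element. This does not
    follow from (i), (iii) and (iv) alone, which also hold for the matrices
    obtained by replacing -1 by an element s with s^2 = 1 of some ring; the
    relation U' = tau tau^U' tau of SL(2, p) rules out the other values of s
    ([sign_cancel], [TconjN]). With that, conjugating (iv) by signed
    permutations gives all Steinberg relations between the elements
    t i j a = (unit_root i j) ^+ a, and conjugating (ii) gives all relations of
    SL(2, p) between t i j and t j i ([root_elem_steinberg]). These elements
    generate G.

    It remains to see that a group with such root elements t i j a, over any
    field F, is faithfully represented by matrices ([steinberg_faithful]). The
    proof is by induction on the set I of indices in use. Fix z in I and let H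
    be generated by the t i j with i != z. The right cosets of H in G
    correspond to the rows with index z of the matrices: for each nonzero row
    vector v an explicit element [vector_rep i v] has row v, its coset does not
    depend on the nonzero coordinate i used to write it, and the generators of
    G permute these cosets as they permute the vectors ([coset_of_row]). So an
    element with trivial matrix lies in H. There it is a product of elements
    t i z, which is determined by column z of its matrix, and of an element
    over the indices other than z, to which the induction applies.

    Surjectivity onto SL(d, p) is Gaussian elimination ([SL_elementary]). *)

Set Implicit Arguments.
Unset Strict Implicit.
Unset Printing Implicit Defensive.

(** * Elementary matrices and words in SL(2) *)

Section Elementary.
Import GRing.Theory.
Local Open Scope ring_scope.
Variable F : fieldType.

Definition elem n (i j : 'I_n) (a : F) : 'M[F]_n := 1%:M + a *: delta_mx i j.

Lemma elemE n (i j k l : 'I_n) a :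
  elem i j a k l = (k == l)%:R + a * ((k == i) && (l == j))%:R.
Proof. by rewrite !mxE. Qed.

Lemma mul_elem p n (A : 'M[F]_(p, n)) k l b i j :
  (A *m elem k l b) i j = A i j + A i k * b * (j == l)%:R.
Proof.
rewrite /elem mulmxDr mulmx1 -scalemxAr mxE [X in _ + X]mxE; congr (_ + _).
rewrite mxE (bigD1 k) //= big1 => [|h /negPf hk]; last by rewrite mxE hk mulr0.
by rewrite mxE eqxx addr0 /= mulrA (mulrC b).
Qed.

Lemma elem_mul p n (A : 'M[F]_(n, p)) k l b i j :
  (elem k l b *m A) i j = A i j + (i == k)%:R * b * A l j.
Proof.
rewrite /elem mulmxDl mul1mx -scalemxAl mxE [X in _ + X]mxE; congr (_ + _).
rewrite mxE (bigD1 l) //= big1 => [|h /negPf hk]; last by rewrite mxE hk andbF mul0r.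
by rewrite mxE eqxx addr0 andbT mulrA (mulrC b).
Qed.

Lemma elemD n (i j : 'I_n) a b :
  i != j -> elem i j a *m elem i j b = elem i j (a + b).
Proof.
move=> ij; rewrite /elem mulmxDl mul1mx mulmxDr mulmx1 -scalemxAl -scalemxAr.
by rewrite mul_delta_mx_0 1?eq_sym // !scaler0 addr0 scalerDl addrA addrAC.
Qed.

Lemma elem0 n (i j : 'I_n) : elem i j 0 = 1%:M.
Proof. by rewrite /elem scale0r addr0. Qed.

Lemma elem_commute n (i j k l : 'I_n) a b : j != k -> i != l ->
  elem i j a *m elem k l b = elem k l b *m elem i j a.
Proof.
move=> jk il; rewrite /elem !mulmxDl !mulmxDr !mul1mx !mulmx1.
rewrite -!scalemxAl -!scalemxAr !mul_delta_mx_0 1?[l == i]eq_sym // !scaler0 !addr0.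
by rewrite -!addrA; congr (_ + _); rewrite addrC.
Qed.

Lemma elem_commutator n (i j k : 'I_n) a b : i != j -> j != k -> i != k ->
  elem i j a *m elem j k b = elem j k b *m elem i j a *m elem i k (a * b).
Proof.
move=> ij jk ik; apply/matrixP => r c; rewrite !mul_elem !elemE.
rewrite !eqxx (negPf ij) (negPf ik) !andbF andbT -!mulnb !natrM mulr0n; ring.
Qed.

Lemma elem_tr n (i j : 'I_n) a : (elem i j a)^T = elem j i a.
Proof. by rewrite /elem linearD linearZ /= trmx_delta trmx1. Qed.

Lemma det_elem n (i j : 'I_n) a : i != j -> \det (elem i j a) = 1.
Proof.
wlog: i j / (j < i)%N => [IH ij|ltji _].
  have := ij; rewrite -val_eqE neq_ltn => /orP[?|?]; last exact: IH.
  by rewrite -det_tr elem_tr IH // eq_sym.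
rewrite det_trig; last first.
  apply/is_trig_mxP => k l lt_kl; rewrite elemE -val_eqE /= (ltn_eqF lt_kl).
  rewrite [_ && _](_ : _ = false) ?mulr0 ?addr0 //; apply/negP.
  by case/andP=> /eqP ki /eqP lj; move: lt_kl; rewrite ki lj ltnNge ltnW.
apply: big1 => k _; rewrite elemE eqxx [_ && _](_ : _ = false) ?mulr0 ?addr0 //.
by apply/negP=> /andP[/eqP-> /eqP ji]; rewrite ji ltnn in ltji.
Qed.

Definition elem2 (l : bool * F) : 'M[F]_2 :=
  if l.1 then elem ord0 ord_max l.2 else elem ord_max ord0 l.2.

Definition mx2 (w : seq (bool * F)) : 'M[F]_2 := \prod_(l <- w) elem2 l.

(** The actions of a letter on row vectors and on column vectors of length 2,
    as pairs, so that explicit words can be evaluated by computation. *)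
Definition act_row (v : F * F) (l : bool * F) : F * F :=
  if l.1 then (v.1, v.2 + v.1 * l.2) else (v.1 + v.2 * l.2, v.2).

Definition act_col (l : bool * F) (v : F * F) : F * F :=
  if l.1 then (v.1 + l.2 * v.2, v.2) else (v.1, v.2 + l.2 * v.1).

Definition row2 u : F * F := foldl act_row (1, 0) u.

Lemma row2_cat u w : row2 (u ++ w) = foldl act_row (row2 u) w.
Proof. exact: foldl_cat. Qed.

(** Associativity of (row) (word) (column). *)
Lemma act_row_col v w u :
  (foldl act_row v u).1 * w.1 + (foldl act_row v u).2 * w.2 =
  v.1 * (foldr act_col w u).1 + v.2 * (foldr act_col w u).2.
Proof.
elim: u v => //= l u IHu v; rewrite {}IHu.
by case: l (foldr _ _ _) => [[] a] [x y] /=; ring.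
Qed.

Lemma mx2_nil : mx2 [::] = 1%:M.
Proof. by rewrite /mx2 big_nil. Qed.

Lemma mx2_cons l u : mx2 (l :: u) = elem2 l *m mx2 u.
Proof. by rewrite /mx2 big_cons. Qed.

Lemma mx2_cat u w : mx2 (u ++ w) = mx2 u *m mx2 w.
Proof. by rewrite /mx2 big_cat. Qed.

Lemma mulmx2E (A B : 'M[F]_2) i j :
  (A *m B) i j = A i ord0 * B ord0 j + A i ord_max * B ord_max j.
Proof.
rewrite mxE big_ord_recl big_ord1; congr (_ + A i _ * B _ j); exact: val_inj.
Qed.

Lemma mx2_row (A : 'M[F]_2) u :
  let B := A *m mx2 u in
  (B ord0 ord0, B ord0 ord_max) = foldl act_row (A ord0 ord0, A ord0 ord_max) u.
Proof.
elim: u A => [|l u IHu] A /=; first by rewrite mx2_nil mulmx1.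
rewrite mx2_cons mulmxA IHu; congr (foldl _ _ _).
rewrite !mulmx2E; case: l => [[] a]; rewrite /elem2 /act_row /= !elemE /=; congr pair; ring.
Qed.

Lemma det_mx2 u : \det (mx2 u) = 1.
Proof.
elim: u => [|l u IHu]; first by rewrite mx2_nil det1.
rewrite mx2_cons det_mulmx IHu mulr1.
by case: l => [[] a] /=; rewrite det_elem.
Qed.

Definition word2_inv (u : seq (bool * F)) :=
  rev [seq (l.1, - l.2) | l <- u].

Lemma mx2_invl u : mx2 (word2_inv u) *m mx2 u = 1%:M.
Proof.
elim: u => [|l u IHu]; first by rewrite -[word2_inv _]/[::] mx2_nil mulmx1.
rewrite /word2_inv /= rev_cons -cats1 -/(word2_inv u) mx2_cat !mx2_cons mx2_nil mulmx1.
have E : elem2 (l.1, - l.2) *m elem2 l = 1%:M.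
  by case: l => [[] a]; rewrite /elem2 /= elemD // addNr elem0.
by rewrite mulmxA -(mulmxA _ _ (elem2 l)) E mulmx1.
Qed.

(** The quotient of the two matrices has first row (1, 0) and determinant 1,
    so it is lower unitriangular. *)
Lemma mx2_lower u u' : row2 u = row2 u' ->
  exists c, mx2 (u ++ word2_inv u' ++ [:: (false, c)]) = 1%:M.
Proof.
move=> eq_row; set A := mx2 u *m mx2 (word2_inv u').
have A'u : A *m mx2 u' = mx2 u.
  by rewrite /A -mulmxA mx2_invl mulmx1.
have r1 v : (mx2 v ord0 ord0, mx2 v ord0 ord_max) = row2 v.
  by have := mx2_row 1%:M v; rewrite mul1mx !mxE.
have eqA: (A ord0 ord0, A ord0 ord_max) = (1, 0).
  have := mx2_row (mx2 u) (word2_inv u'); rewrite -/A /= => ->.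
  rewrite r1 eq_row -r1 -(mx2_row (mx2 u') (word2_inv u')).
  have := mx2_invl u' => /mulmx1C ->; by rewrite !mxE.
have [A00 A01] : A ord0 ord0 = 1 /\ A ord0 ord_max = 0 by case: eqA.
have A11 : A ord_max ord_max = 1.
  have := det_mulmx (mx2 u) (mx2 (word2_inv u')); rewrite -/A !det_mx2 mulr1.
  have lE : lift ord0 ord0 = ord_max :> 'I_2 by apply: val_inj.
  rewrite (expand_det_row _ ord0) !big_ord_recl big_ord0 lE A00 A01 mul0r addr0.
  by rewrite mul1r /cofactor addn0 expr0 mul1r addr0 det_mx11 !mxE lE.
exists (- A ord_max ord0); rewrite catA !mx2_cat -/A mx2_cons mx2_nil mulmx1.
rewrite /elem2 /=.
suff -> : A = elem ord_max ord0 (A ord_max ord0).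
  by rewrite elemE eqxx add0r mulr1 elemD // addrN elem0.
have two (k : 'I_2) : k = ord0 \/ k = ord_max.
  by case: k => [[|[]]] // ?; [left | right]; exact: val_inj.
by apply/matrixP => k l; rewrite !elemE; case: (two k) => ->; case: (two l) => ->;
   rewrite ?A00 ?A01 ?A11 /= ?eqxx ?mulr0 ?mulr1 ?addr0 ?add0r.
Qed.

End Elementary.

(** * Elementary matrices generate SL *)

Section SpecialLinearGeneration.
Import GRing.Theory.
Local Open Scope ring_scope.
Variables (F : fieldType) (n : nat) (P : 'M[F]_n -> Prop).
Hypotheses (P1 : P 1%:M)
  (Pr : forall A i j a, i != j -> P (A *m elem i j a) -> P A)
  (Pl : forall A i j a, i != j -> P (elem i j a *m A) -> P A).

Definition id_outside (I : {set 'I_n}) (A : 'M[F]_n) : Prop :=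
  forall i j, ~~ ((i \in I) && (j \in I)) -> A i j = (i == j)%:R.

Lemma id_outside_mul_elem (I : {set 'I_n}) A k l b : k \in I -> l \in I ->
  id_outside I A -> id_outside I (A *m elem k l b).
Proof.
move=> Ik Il IA i j Iij; rewrite mul_elem IA //.
have [Ii|Ii] := boolP (i \in I).
  rewrite [j == l](_ : _ = false) ?mulr0 ?addr0 //.
  by apply: contraNF Iij => /eqP->; rewrite Ii.
rewrite IA ?(negPf Ii) // [i == k](_ : _ = false) ?mul0r ?addr0 //.
by apply: contraNF Ii => /eqP->.
Qed.

Lemma id_outside_elem_mul (I : {set 'I_n}) A k l b : k \in I -> l \in I ->
  id_outside I A -> id_outside I (elem k l b *m A).
Proof.
move=> Ik Il IA i j Iij; rewrite elem_mul IA //.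
have [Ij|Ij] := boolP (j \in I).
  rewrite [i == k](_ : _ = false) ?mul0r ?addr0 //.
  by apply: contraNF Iij => /eqP->; rewrite Ij andbT.
rewrite [A l j]IA ?(negPf Ij) ?andbF // [l == j](_ : _ = false) ?mulr0 ?addr0 //.
by apply: contraNF Ij => /eqP<-.
Qed.

Section Pivot.
Variables (I : {set 'I_n}) (z : 'I_n).
Hypothesis Iz : z \in I.
Hypothesis IH : forall A, id_outside (I :\ z) A -> \det A = 1 -> P A.

Lemma clear_col A : id_outside I A -> \det A = 1 -> A z z = 1 ->
  (forall j, j != z -> A z j = 0) -> P A.
Proof.
move=> IA dA Azz Az0; have [N] := ubnP #|[set i | (i != z) && (A i z != 0)]|.
elim: N A IA dA Azz Az0 => // N IHN A IA dA Azz Az0 leN.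
have [i /andP[iz Aiz]|no] := pickP [pred i | (i != z) && (A i z != 0)].
  have Ii : i \in I.
    by apply: contraNT Aiz => Ii; rewrite IA ?(negPf Ii) // (negPf iz).
  apply: (Pl iz (a := - A i z)); apply: IHN => [|||j jz|].
  - exact: id_outside_elem_mul.
  - by rewrite det_mulmx det_elem // mul1r.
  - by rewrite elem_mul eq_sym (negPf iz) !mul0r addr0.
  - by rewrite elem_mul eq_sym (negPf iz) !mul0r addr0 Az0.
  rewrite ltnS in leN; apply: leq_trans leN; apply: proper_card.
  apply/properP; split; last first.
    by exists i; rewrite !inE iz ?Aiz //= elem_mul eqxx Azz mul1r mulr1 addrN eqxx.
  apply/fintype.subsetP => k; rewrite !inE elem_mul Azz mulr1 => /andP[->] /=.
  by have [->|_] := eqVneq k i; rewrite ?mul1r ?addrN ?eqxx // mul0r addr0.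
apply: IH => // i j; rewrite !inE; have [->|iz] := eqVneq i z => /=.
  by have [->|jz _] := eqVneq j z; rewrite ?Azz ?eqxx // Az0.
have [->|jz] := eqVneq j z => /= [_|]; last exact: IA.
by have /= := no i; rewrite iz (negPf iz) /= => /negbFE/eqP.
Qed.

Lemma clear_row A : id_outside I A -> \det A = 1 -> A z z = 1 -> P A.
Proof.
move=> IA dA Azz; have [N] := ubnP #|[set j | (j != z) && (A z j != 0)]|.
elim: N A IA dA Azz => // N IHN A IA dA Azz leN.
have [j /andP[jz Azj]|no] := pickP [pred j | (j != z) && (A z j != 0)].
  have zj : z != j by rewrite eq_sym.
  have Ij : j \in I.
    by apply: contraNT Azj => Ij; rewrite IA ?(negPf Ij) ?andbF // (negPf zj).
  apply: (Pr zj (a := - A z j)); apply: IHN.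
  - exact: id_outside_mul_elem.
  - by rewrite det_mulmx det_elem // mulr1.
  - by rewrite mul_elem (negPf zj) mulr0 addr0.
  rewrite ltnS in leN; apply: leq_trans leN; apply: proper_card.
  apply/properP; split; last first.
    by exists j; rewrite !inE jz ?Azj //= mul_elem eqxx Azz mul1r mulr1 addrN eqxx.
  apply/fintype.subsetP => k; rewrite !inE mul_elem Azz mul1r => /andP[->] /=.
  by have [->|_] := eqVneq k j; rewrite ?mulr1 ?addrN ?eqxx // mulr0 addr0.
apply: clear_col => // j jz.
by have /= := no j; rewrite jz /= => /negbFE/eqP.
Qed.

(** A nonzero entry outside the diagonal makes it possible to turn the diagonal
    entry into 1, which spares the scaling of a row. *)
Lemma create_pivot A j : id_outside I A -> \det A = 1 -> j != z ->
  A z j != 0 -> P A.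
Proof.
move=> IA dA jz Azj; have zj : z != j by rewrite eq_sym.
have Ij : j \in I.
  by apply: contraNT Azj => Ij; rewrite IA ?(negPf Ij) ?andbF // (negPf zj).
apply: (Pr jz (a := (1 - A z z) / A z j)); apply: clear_row.
- exact: id_outside_mul_elem.
- by rewrite det_mulmx det_elem // mulr1.
by rewrite mul_elem eqxx mulr1; field.
Qed.

Lemma eliminate A : id_outside I A -> \det A = 1 -> P A.
Proof.
move=> IA dA.
have [j /andP[jz Azj]|no] := pickP [pred j | (j != z) && (A z j != 0)].
  exact: create_pivot Azj.
have Az0 j : j != z -> A z j = 0.
  by move=> jz; have /= := no j; rewrite jz /= => /negbFE/eqP.
have [m /andP[Im mz]|none] := pickP [pred m in I | m != z].
  have zm : z != m by rewrite eq_sym.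
  have Azz : A z z != 0.
    apply: contraTneq (oner_neq0 F) => Azz; rewrite -dA (expand_det_row _ z).
    rewrite big1 ?eqxx // => j _.
    by have [->|jz] := eqVneq j z; rewrite ?Azz ?Az0 ?mul0r.
  apply: (Pr zm (a := 1)); apply: (@create_pivot _ m) => //.
  - exact: id_outside_mul_elem.
  - by rewrite det_mulmx det_elem // mulr1.
  by rewrite mul_elem eqxx Az0 // add0r !mulr1.
have I1 i : i \in I -> i = z.
  by move=> Ii; have /= := none i; rewrite Ii /= => /negbFE/eqP.
have outs i j : (i, j) != (z, z) -> A i j = (i == j)%:R.
  move=> ne; apply: IA; apply: contra ne => /andP[/I1-> /I1->]; exact: eqxx.
apply: clear_row => //; move: dA; rewrite det_trig; last first.
  apply/is_trig_mxP => i j ltij; rewrite outs -?val_eqE /= ?(ltn_eqF ltij) //.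
  by apply: contraTneq ltij => -[-> ->]; rewrite ltnn.
rewrite (bigD1 z) //= big1 ?mulr1 // => i iz.
by rewrite outs ?eqxx //; apply: contraNneq iz => -[->].
Qed.

End Pivot.

(** Gaussian elimination, in the form of an induction principle: P need only
    descend along elementary operations. *)
Theorem SL_elementary A : \det A = 1 -> P A.
Proof.
have : id_outside [set: 'I_n] A by move=> i j; rewrite !inE.
have [N] := ubnP #|[set: 'I_n]|; move: [set: _] => I.
elim: N I A => // N IHN I A leN IA dA.
have [z Iz|I0] := pickP [in I].
  apply: (eliminate Iz) => // B IB dB; apply: (IHN (I :\ z)) => //.
  by move: leN; rewrite (cardsD1 z) Iz.
suff -> : A = 1%:M by [].
by apply/matrixP => i j; rewrite IA ?mxE // [i \in I]I0.
Qed.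

End SpecialLinearGeneration.

(** * Groups with root elements satisfying the Steinberg relations *)

Section RootRelations.
Import GroupScope GRing.Theory.
Local Open Scope group_scope.
Variables (F : fieldType) (n : nat) (G : groupType).
Variable t : 'I_n -> 'I_n -> F -> G.

Definition eval2 i j (w : seq (bool * F)) : G :=
  \prod_(l <- w) (if l.1 then t i j l.2 else t j i l.2).

(** The last field is what separates SL(n, F) from its Steinberg group, which
    can be a nontrivial central extension over an infinite field. It is stated
    on words, and so only speaks of generators of SL(2, F). *)
Record steinberg_relations : Prop := SteinbergRelations {
  st_add : forall i j a b, i != j -> t i j a * t i j b = t i j (a + b)%R;
  st_comm : forall i j k a b, i != j -> j != k -> i != k ->
    [~ t i j a, t j k b] = t i k (a * b)%R;
  st_commute : forall i j k l a b, i != j -> k != l -> j != k -> i != l ->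
    commute (t i j a) (t k l b);
  st_rank2 : forall i j w, i != j -> mx2 w = 1%R -> eval2 i j w = 1
}.

Hypothesis St : steinberg_relations.

Lemma st0 i j : i != j -> t i j 0%R = 1.
Proof.
by move=> ij; apply: (mulgI (t i j 0%R)); rewrite st_add // addr0 mulg1.
Qed.

Lemma stN i j a : i != j -> t i j (- a)%R = (t i j a)^-1.
Proof.
move=> ij; apply: (mulgI (t i j a)).
by rewrite st_add // addrN mulgV st0.
Qed.

Lemma st_swap i j k a b : i != j -> j != k -> i != k ->
  t i j a * t j k b = t j k b * t i j a * t i k (a * b)%R.
Proof. by move=> *; rewrite commgC st_comm. Qed.

Lemma st_swapl i j k a b : i != j -> j != k -> i != k ->
  t i j a * t j k b = t i k (a * b)%R * t j k b * t i j a.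
Proof.
move=> ij jk ik; rewrite st_swap // -mulgA.
have -> : t i j a * t i k (a * b)%R = t i k (a * b)%R * t i j a.
  by rewrite (st_commute St) // eq_sym.
by rewrite !mulgA; congr (_ * _); rewrite (st_commute St) // eq_sym.
Qed.

Lemma eval2_cat i j u w : eval2 i j (u ++ w) = eval2 i j u * eval2 i j w.
Proof. by rewrite /eval2 big_cat. Qed.

Lemma eval2_cons i j l w :
  eval2 i j (l :: w) = (if l.1 then t i j l.2 else t j i l.2) * eval2 i j w.
Proof. by rewrite /eval2 big_cons. Qed.

Lemma eval2_nil i j : eval2 i j [::] = 1.
Proof. by rewrite /eval2 big_nil. Qed.

Lemma eval2_upper i j u a :
  eval2 i j u * t i j a = eval2 i j (u ++ [:: (true, a)]).
Proof. by rewrite eval2_cat eval2_cons eval2_nil mulg1. Qed.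

Lemma eval2_lower i j u a :
  eval2 i j u * t j i a = eval2 i j (u ++ [:: (false, a)]).
Proof. by rewrite eval2_cat eval2_cons eval2_nil mulg1. Qed.

Lemma eval2_inv i j w : i != j -> eval2 i j (word2_inv w) = (eval2 i j w)^-1.
Proof.
move=> ij; elim: w => [|l w IHw]; first by rewrite !eval2_nil invg1.
rewrite /word2_inv /= rev_cons -cats1 eval2_cat eval2_cons eval2_nil mulg1 /=.
rewrite -/(word2_inv w) {}IHw eval2_cons invgM.
by case: l.1; rewrite stN // eq_sym.
Qed.

Lemma eval2_row i j u u' : i != j -> row2 u = row2 u' ->
  exists c, eval2 i j u = t j i c * eval2 i j u'.
Proof.
move=> ij /mx2_lower[c /(st_rank2 St ij)].
have ji : j != i by rewrite eq_sym.
rewrite !eval2_cat eval2_inv // eval2_cons eval2_nil mulg1 /= => e.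
have e' : eval2 i j u * (eval2 i j u')^-1 = t j i (- c)%R.
  by rewrite stN //; apply: (mulIg (t j i c)); rewrite mulVg -mulgA.
by exists (- c)%R; rewrite -e' mulgVK.
Qed.

(** The elements t k i x * t k j y form a plane, on which the SL(2) attached to
    i and j acts by conjugation as it acts on row vectors; in [plane_col] the
    action is the one on column vectors. *)
Lemma plane_row i j k u x y : i != j -> k != i -> k != j ->
  t k i x * t k j y * eval2 i j u =
  eval2 i j u * (t k i (foldl (@act_row F) (x, y) u).1 *
                 t k j (foldl (@act_row F) (x, y) u).2).
Proof.
move=> ij ki kj; have ji : j != i by rewrite eq_sym.
have ik : i != k by rewrite eq_sym.
have jk : j != k by rewrite eq_sym.
elim: u x y => [|l u IHu] x y; first by rewrite eval2_nil mulg1 mul1g.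
rewrite eval2_cons /= -(mulgA _ (eval2 i j u)).
rewrite (surjective_pairing (act_row (x, y) l)) -IHu !mulgA; congr (_ * _).
case: l => [[] a]; rewrite /act_row /=.
  rewrite -(mulgA _ _ (t i j a)) (st_commute St y a kj ij ji kj) mulgA.
  by rewrite st_swap // -!(mulgA (t i j a * _)) st_add // addrC.
rewrite -(mulgA _ _ (t j i a)) st_swap // -(st_add St _ _ ki) !mulgA.
rewrite (st_commute St x a ki ji ij ki) -!mulgA; congr (_ * (_ * _)).
by rewrite (st_commute St).
Qed.

Lemma plane_col i j k u x y : i != j -> k != i -> k != j ->
  eval2 i j u * (t i k x * t j k y) =
  t i k (foldr (@act_col F) (x, y) u).1 *
  t j k (foldr (@act_col F) (x, y) u).2 * eval2 i j u.
Proof.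
move=> ij ki kj; have ji : j != i by rewrite eq_sym.
have ik : i != k by rewrite eq_sym.
have jk : j != k by rewrite eq_sym.
elim: u => [|l u IHu] /=; first by rewrite eval2_nil mulg1 mul1g.
rewrite eval2_cons /= -mulgA IHu !mulgA; congr (_ * _).
case: (foldr _ _ _) => x' y'; case: l => [[] a]; rewrite /act_col /=.
  rewrite (st_commute St a x' ij ik ji ik) -mulgA st_swapl //.
  by rewrite !mulgA st_add.
rewrite st_swapl // -!mulgA (st_commute St a y' ji jk) // !mulgA; congr (_ * _).
rewrite addrC -(st_add St _ _ jk) !mulgA; congr (_ * _).
by rewrite (st_commute St).
Qed.
End RootRelations.

(** * Cosets of the stabilizer of a basis vector *)

Section Cosets.
Import GroupScope GRing.Theory.
Local Open Scope group_scope.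
Variables (F : fieldType) (n : nat) (G : groupType).
Variable t : 'I_n -> 'I_n -> F -> G.
Hypothesis St : steinberg_relations t.
(** The words of the matrices with first row (0, a), second row (-1/a, 0), and
    diag(a, 1/a). *)
Definition weyl_word (a : F) := [:: (true, a); (false, (- a^-1)%R); (true, a)].
Definition torus_word (a : F) := weyl_word a ++ weyl_word (-1)%R.

Lemma row2_weyl (a : F) : a != 0%R -> row2 (weyl_word a) = (0%R, a).
Proof. by move=> a0; rewrite /row2 /act_row /=; congr pair; field. Qed.

Lemma row2_torus (a : F) : a != 0%R -> row2 (torus_word a) = (a, 0%R).
Proof.
move=> a0; rewrite row2_cat row2_weyl // /act_row /=.
by congr pair; field; rewrite ?oppr_eq0 ?oner_eq0.
Qed.

Lemma weyl_col i k j c : i != k -> j != i -> j != k ->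
  eval2 t i k (weyl_word 1%R) * t k j c = t i j c * eval2 t i k (weyl_word 1%R).
Proof.
move=> ik ji jk; have := plane_col St (weyl_word 1%R) 0%R c ik ji jk.
rewrite /= /act_col /= (st0 St) 1?eq_sym // mul1g => ->.
rewrite !(mulr0, mul1r, add0r, addr0, invr1, mulN1r, addrN).
by rewrite (st0 St) 1?eq_sym // mulg1.
Qed.

Lemma weyl_row i k j c : i != k -> j != i -> j != k ->
  t j i c * eval2 t i k (weyl_word 1%R) = eval2 t i k (weyl_word 1%R) * t j k c.
Proof.
move=> ik ji jk; have := plane_row St (weyl_word 1%R) c 0%R ik ji jk.
rewrite /= /act_row /= (st0 St) // mulg1 => ->.
by rewrite invr1 !(mulr1, add0r, mulrN1, addrN, mul0r, addr0) (st0 St) // mul1g.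
Qed.

(** A subgroup, although no constructor mentions inverses: the inverse of a
    root element is a root element. *)
Inductive gen (R : rel 'I_n) : G -> Prop :=
| gen1 : gen R 1
| gen_cons i j a g : R i j -> i != j -> gen R g -> gen R (t i j a * g).

Lemma gen_mul R g h : gen R g -> gen R h -> gen R (g * h).
Proof.
move=> Rg Rh; elim: Rg => [|i j a g' Rij ij _ IH]; first by rewrite mul1g.
by rewrite -mulgA; exact: gen_cons.
Qed.

Lemma gen_root (R : rel 'I_n) i j a : R i j -> i != j -> gen R (t i j a).
Proof. by move=> *; rewrite -[t i j a]mulg1; apply/gen_cons => //; exact: gen1. Qed.

Lemma gen_inv R g : gen R g -> gen R g^-1.
Proof.
elim=> [|i j a h Rij ij _ IH]; first by rewrite invg1; exact: gen1.
by rewrite invgM -(stN St) //; apply/gen_mul/gen_root.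
Qed.

Lemma gen_sub (R R' : rel 'I_n) g : subrel R R' -> gen R g -> gen R' g.
Proof.
move=> sR; elim=> [|i j a h Rij ij _ IH]; first exact: gen1.
by apply/gen_cons => //; exact: sR.
Qed.

Lemma gen_eval2 (R : rel 'I_n) i j u : R i j -> R j i -> i != j ->
  gen R (eval2 t i j u).
Proof.
move=> Rij Rji ij; elim: u => [|l u IHu]; first by rewrite eval2_nil; exact: gen1.
by rewrite eval2_cons; case: l.1; apply/gen_cons => //; rewrite eq_sym.
Qed.

Definition row_elem (J : pred 'I_n) i (c : 'I_n -> F) : G :=
  \prod_(j | J j) t i j (c j).

Lemma row_elemD J i c l x : ~~ J i -> J l ->
  row_elem J i c * t i l x = row_elem J i (fun j => c j + x * (j == l)%:R)%R.
Proof.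
move=> Ji Jl; have ne j : J j -> i != j.
  by move=> Jj; apply: contraNneq Ji => ->.
transitivity (row_elem J i c * row_elem J i (fun j => x * (j == l)%:R)%R).
  congr (_ * _); rewrite /row_elem (big_only1 l) ?eqxx ?mulr1 // => j /negPf-> Jj.
  by rewrite mulr0 (st0 St) // ne.
rewrite -prodgM_commute => [|j k Jj Jk]; last first.
  by apply: (st_commute St); rewrite // 1?ne // eq_sym ne.
by apply: eq_bigr => j Jj; rewrite (st_add St) // ne.
Qed.

(** On a row vector c, the matrix of t k l b adds b times coordinate k to
    coordinate l. *)
Lemma row_elem_comm J i c k l b : ~~ J i -> J k -> J l -> k != l ->
  row_elem J i c * t k l b =
  t k l b * row_elem J i (fun j => c j + c k * b * (j == l)%:R)%R.
Proof.
move=> Ji Jk Jl kl; have ne j : J j -> i != j.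
  by move=> Jj; apply: contraNneq Ji => ->.
have li : l != i by rewrite eq_sym ne.
pose c0 j := (c j - c k * (j == k)%:R)%R.
have c0k : c0 k = 0%R by rewrite /c0 eqxx mulr1 addrN.
have cE : row_elem J i c = row_elem J i c0 * t i k (c k).
  by rewrite row_elemD //; apply: eq_bigr => j _; rewrite /c0 subrK.
have comm0 : row_elem J i c0 * t k l b = t k l b * row_elem J i c0.
  apply/commute_sym/commute_prod => j Jj; have [->|jk] := eqVneq j k.
    by rewrite c0k (st0 St) ?ne //; exact: commute1.
  by apply: (st_commute St); rewrite // ?ne // eq_sym.
rewrite cE -mulgA (st_swap St) ?ne // !mulgA comm0 -(mulgA (t k l b)) -cE.
by rewrite -mulgA row_elemD.
Qed.

Definition col_elem (J : pred 'I_n) j (c : 'I_n -> F) : G :=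
  \prod_(i | J i) t i j (c i).

Lemma col_elemD J j c k x : ~~ J j -> J k ->
  t k j x * col_elem J j c = col_elem J j (fun i => c i + x * (i == k)%:R)%R.
Proof.
move=> Jj Jk; have ne i : J i -> i != j.
  by move=> Ji; apply: contraNneq Jj => <-.
transitivity (col_elem J j (fun i => x * (i == k)%:R)%R * col_elem J j c).
  congr (_ * _); rewrite /col_elem (big_only1 k) ?eqxx ?mulr1 // => i /negPf-> Ji.
  by rewrite mulr0 (st0 St) // ne.
rewrite -prodgM_commute => [|i l Ji Jl]; last first.
  by apply: (st_commute St); rewrite // 1?ne // eq_sym ne.
by apply: eq_bigr => i Ji; rewrite (st_add St) 1?addrC // ne.
Qed.

Lemma col_elem_comm J j c k l b : ~~ J j -> J k -> J l -> k != l ->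
  t k l b * col_elem J j c =
  col_elem J j (fun i => c i + b * c l * (i == k)%:R)%R * t k l b.
Proof.
move=> Jj Jk Jl kl; have ne i : J i -> i != j.
  by move=> Ji; apply: contraNneq Jj => <-.
have jk : j != k by rewrite eq_sym ne.
pose c0 i := (c i - c l * (i == l)%:R)%R.
have c0l : c0 l = 0%R by rewrite /c0 eqxx mulr1 addrN.
have cE : col_elem J j c = t l j (c l) * col_elem J j c0.
  by rewrite col_elemD //; apply: eq_bigr => i _; rewrite /c0 subrK.
have comm0 : t k l b * col_elem J j c0 = col_elem J j c0 * t k l b.
  apply/commute_prod => i Ji; have [->|il] := eqVneq i l.
    by rewrite c0l (st0 St) ?ne //; exact: commute1.
  by apply: (st_commute St); rewrite // ?ne // eq_sym.
rewrite {1}cE mulgA (st_swapl St) ?ne // -!mulgA comm0 !(mulgA (t l j _)) -cE.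
by rewrite mulgA col_elemD.
Qed.

Section StabilizerCosets.
Variables (I : {set 'I_n}) (z : 'I_n).

(** The roots (i, j) whose transvection fixes the basis vector z. *)
Definition stab_rel : rel 'I_n := fun i j => [&& i \in I, i != z & j \in I].

Definition eqc g g' := gen stab_rel (g * g'^-1).

Lemma eqc_refl g : eqc g g.
Proof. by rewrite /eqc mulgV; exact: gen1. Qed.

Lemma eqc_sym g g' : eqc g g' -> eqc g' g.
Proof. by move=> /gen_inv; rewrite /eqc invgM invgK. Qed.

Lemma eqc_trans g2 g1 g3 : eqc g1 g2 -> eqc g2 g3 -> eqc g1 g3.
Proof.
by rewrite /eqc => e e'; have := gen_mul e e'; rewrite !mulgA mulgVK.
Qed.

Lemma eqcMr x g g' : eqc g g' -> eqc (g * x) (g' * x).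
Proof. by rewrite /eqc invgM mulgA mulgK. Qed.

Lemma eqcMl h g : gen stab_rel h -> eqc (h * g) g.
Proof. by rewrite /eqc mulgK. Qed.

Lemma eqc_eval2 m u u' : z \in I -> m \in I -> m != z -> row2 u = row2 u' ->
  eqc (eval2 t z m u) (eval2 t z m u').
Proof.
move=> Iz Im mz e; have zm : z != m by rewrite eq_sym.
have [c ->] := eval2_row St zm e.
by apply/eqcMl/gen_root; rewrite // /stab_rel Im mz.
Qed.

(** Row k is an abelian group on which t p q acts linearly, adding a multiple of
    coordinate p to coordinate q. *)
Lemma gen_row_conj k p q a g : p != q -> p != k -> q != k -> q \in I ->
  gen (fun i j => (i == k) && (j \in I)) g ->
  gen (fun i j => (i == k) && (j \in I)) (t p q a * g * (t p q a)^-1).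
Proof.
move=> pq pk qk Iq; elim=> [|i j c h /andP[/eqP-> Ij] kj _ IH].
  by rewrite mulg1 mulgV; exact: gen1.
suff [h' Rh' E] : exists2 h', gen (fun i j => (i == k) && (j \in I)) h' &
    t p q a * t k j c = h' * t p q a.
  by rewrite !mulgA E -!mulgA; apply: gen_mul => //; rewrite !mulgA.
have [ejp|jp] := eqVneq j p; last first.
  exists (t k j c); first by apply: gen_root; rewrite // eqxx.
  by apply: (st_commute St); rewrite // eq_sym.
exists (t k q (- (c * a))%R * t k j c).
  by apply: gen_mul; apply: gen_root; rewrite ?eqxx // eq_sym.
rewrite -mulgA ejp (st_swapl St) 1?[k == _]eq_sym //.
by rewrite (stN St) 1?[k == _]eq_sym // -!mulgA mulKg.
Qed.

(** The word u takes the basis vector z to a vector supported on z and m, which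
    the transvection t k j fixes when its coordinate k vanishes; the coset of u
    is then fixed as well. If k is not z or m, conjugation by u keeps t k j in
    row k; if j is not z or m, it stays in column j by [plane_col]; the last
    case takes place in SL(2). *)
Lemma eval2_fix m u k j c : z \in I -> m \in I -> m != z ->
    k \in I -> j \in I -> k != j ->
    (k = z -> (row2 u).1 = 0%R) -> (k = m -> (row2 u).2 = 0%R) ->
  eqc (eval2 t z m u * t k j c) (eval2 t z m u).
Proof.
move=> Iz Im mz Ik Ij kj kzP kmP; have zm : z != m by rewrite eq_sym.
have [kz|/negPf kz] := eqVneq k z; last have [km|/negPf km] := eqVneq k m.
- have [jm|jm] := eqVneq j m.
    rewrite kz jm; have /= := @eqc_eval2 m (u ++ [:: (true, c)]) u.
    rewrite eval2_cat eval2_cons eval2_nil mulg1 /=; apply=> //.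
    rewrite row2_cat /= /act_row /= (kzP kz) mul0r addr0.
    by rewrite -(kzP kz) -surjective_pairing.
  have jz : j != z by rewrite eq_sym -kz.
  have := plane_col St u c 0%R zm jz jm; rewrite kz (st0 St) 1?eq_sym //.
  rewrite mulg1 => ->; have := act_row_col (1, 0)%R (c, 0)%R u.
  rewrite -/(row2 u) kzP //= mul0r mulr0 addr0 mul1r mul0r addr0 => <-.
  rewrite (st0 St) 1?eq_sym // mul1g; apply/eqcMl/gen_root; last by rewrite eq_sym.
  by rewrite /stab_rel Im mz.
- have mj : m != j by rewrite -km.
  have [jz|jz] := eqVneq j z.
    rewrite km jz; have /= := @eqc_eval2 m (u ++ [:: (false, c)]) u.
    rewrite eval2_cat eval2_cons eval2_nil mulg1 /=; apply=> //.
    rewrite row2_cat /= /act_row /= (kmP km) mul0r addr0.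
    by rewrite -(kmP km) -surjective_pairing.
  have jm : j != m by rewrite eq_sym.
  have := plane_col St u 0%R c zm jz jm; rewrite km (st0 St) 1?eq_sym //.
  rewrite mul1g => ->; have := act_row_col (1, 0)%R (0, c)%R u.
  rewrite -/(row2 u) (kmP km) /= mul0r mulr0 add0r mul1r mul0r addr0 => <-.
  rewrite (st0 St) 1?eq_sym // mul1g; apply/eqcMl/gen_root; last by rewrite eq_sym.
  by rewrite /stab_rel Im mz.
apply: (@gen_sub (fun i j => (i == k) && (j \in I))).
  by move=> i l /andP[/eqP-> Il]; rewrite /stab_rel Ik kz.
elim: u {kzP kmP} => [|l u IHu].
  by rewrite eval2_nil mul1g invg1 mulg1; apply: gen_root; rewrite // eqxx.
rewrite eval2_cons invgM; set s := (if _ then _ else _).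
have -> w : s * w * t k j c * (w^-1 * s^-1) = s * (w * t k j c * w^-1) * s^-1.
  by rewrite !mulgA.
by rewrite /s; case: l.1; apply: gen_row_conj; rewrite // 1?eq_sym ?kz ?km.
Qed.

End StabilizerCosets.

End Cosets.

(** * Cosets are determined by row vectors *)

Section Faithfulness.
Import GroupScope GRing.Theory.
Local Open Scope group_scope.
Variables (F : fieldType) (n : nat) (G : groupType).
Variable t : 'I_n -> 'I_n -> F -> G.
Hypothesis St : steinberg_relations t.
Local Notation gen := (gen t).
Local Notation eval2 := (eval2 t).
Local Notation row_elem := (row_elem t).
Local Notation col_elem := (col_elem t).
Lemma gen_rind (R : rel 'I_n) (P : G -> Prop) : P 1 ->
    (forall g i j a, P g -> R i j -> i != j -> P (g * t i j a)) ->
  forall g, gen R g -> P g.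
Proof.
move=> P1 Pt g Rg; suff: forall h, P h -> P (h * g).
  by move=> /(_ 1 P1); rewrite mul1g.
elim: Rg => [|i j a g' Rij ij _ IH] h Ph; first by rewrite mulg1.
by rewrite mulgA; apply/IH/Pt.
Qed.

Lemma row_elem_split J i k c : ~~ J i -> J k ->
  row_elem J i c = t i k (c k) * row_elem [pred j | J j && (j != k)] i c.
Proof.
move=> Ji Jk; have ne j : J j -> i != j.
  by move=> Jj; apply: contraNneq Ji => ->.
have -> : t i k (c k) = \prod_(j | J j) (if j == k then t i j (c j) else 1).
  by rewrite (big_only1 k) ?eqxx // => j /negPf->.
rewrite /row_elem [in RHS]big_mkcondr -prodgM_commute => [|j l Jj Jl]; last first.
  case: (j == k); last exact/commute_sym/commute1.
  case: (l != k); last exact: commute1.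
  by apply: (st_commute St); rewrite ?ne // eq_sym ne.
by apply: eq_bigr => j _; case: (j == k); rewrite ?mulg1 ?mul1g.
Qed.

Lemma row_elem_root J i k c a : ~~ J i -> ~~ J k -> i != k ->
  row_elem J i c * t i k a = t i k a * row_elem J i c.
Proof.
move=> Ji Jk ik; have ne j : J j -> i != j.
  by move=> Jj; apply: contraNneq Ji => ->.
apply/commute_sym/commute_prod => j Jj.
by apply: (st_commute St); rewrite ?(ne j) // eq_sym.
Qed.

Lemma row_elem_swap J i k e c : ~~ J i -> ~~ J k -> k != i ->
  t k i e * row_elem J i c =
  row_elem J i c * (row_elem J k (fun j => e * c j)%R * t k i e).
Proof.
move=> Ji Jk ki; have nei j : J j -> i != j.
  by move=> Jj; apply: contraNneq Ji => ->.
have nek j : J j -> k != j.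
  by move=> Jj; apply: contraNneq Jk => ->.
have ck j l : J j -> J l -> commute (t i j (c j)) (t k l (e * c l)%R).
  by move=> Jj Jl; apply: (st_commute St); rewrite ?nei ?nek // eq_sym nek.
rewrite mulgA /row_elem -prodgM_commute //.
rewrite conjgCV conjg_prod; congr (_ * _); apply: eq_bigr => j Jj.
rewrite /conjg invgK mulgA (st_swapl St) ?(nei j) ?(nek j) //. rewrite mulgK.
by apply: commute_sym; exact: ck.
Qed.

Section Axes.
Variables (I : {set 'I_n}) (z m : 'I_n).
Hypotheses (Iz : z \in I) (Im : m \in I) (mz : m != z).
Local Notation eqc := (eqc t I z).

Let zm : z != m. Proof. by rewrite eq_sym. Qed.

(** An element taking the basis vector z to a times the basis vector i. For
    i = z it has to be built with an auxiliary index m; [axis_z] shows that its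
    coset does not depend on m. *)
Definition axis i a : G :=
  if i == z then eval2 z m (torus_word a) else eval2 z i (weyl_word a).

Lemma axis_fix1 i k j a c : i \in I -> k \in I -> j \in I -> k != i ->
  k != j -> a != 0%R -> eqc (axis i a * t k j c) (axis i a).
Proof.
move=> Ii Ik Ij ki kj a0; rewrite /axis; case: eqP => [iz|/eqP iz].
  apply: (eval2_fix St) => // [kz|_]; last by rewrite row2_torus.
  by rewrite kz iz eqxx in ki.
apply: (eval2_fix St) => // [_|ek]; first by rewrite row2_weyl.
by rewrite ek eqxx in ki.
Qed.

Lemma axis_fix i a h : i \in I -> a != 0%R ->
  gen (fun k j => [&& k \in I, k != i & j \in I]) h ->
  eqc (axis i a * h) (axis i a).
Proof.
move=> Ii a0; elim=> [|k j c g /and3P[Ik ki Ij] kj _ IH].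
  by rewrite mulg1; exact: eqc_refl.
rewrite mulgA; apply: eqc_trans _ IH.
by apply: eqcMr; exact: axis_fix1.
Qed.

(** A Weyl element w exchanging m and k lies in the stabilizer, fixes the coset
    of [axis z a], and conjugates the torus element built with m to the one
    built with k. *)
Lemma axis_z k a : k \in I -> k != z -> a != 0%R ->
  eqc (eval2 z k (torus_word a)) (axis z a).
Proof.
move=> Ik kz a0; have zk : z != k by rewrite eq_sym.
have [->|km] := eqVneq k m; first by rewrite /axis eqxx; exact: eqc_refl.
have mk : m != k by rewrite eq_sym.
pose w := eval2 m k (weyl_word 1%R).
have sw u : eval2 z m u * w = w * eval2 z k u.
  elim: u => [|l u IHu]; first by rewrite !eval2_nil mul1g mulg1.
  rewrite !eval2_cons -mulgA IHu !mulgA; congr (_ * _).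
  by case: l.1; rewrite ?(weyl_row St) // (weyl_col St).
apply: (eqc_trans (g2 := axis z a * w)).
  apply: (eqc_sym St); rewrite {1}/axis eqxx sw.
  by apply/eqcMl/gen_eval2; rewrite // /stab_rel ?Im ?Ik ?mz ?kz.
by apply: axis_fix => //; apply: gen_eval2; rewrite ?Im ?Ik ?mz ?kz.
Qed.

Lemma axis_weyl i a : i \in I -> i != z -> a != 0%R ->
  eqc (axis z a * eval2 z i (weyl_word 1%R)) (axis i a).
Proof.
move=> Ii iz a0.
apply: eqc_trans (eqcMr _ (eqc_sym St (axis_z Ii iz a0))) _.
rewrite -eval2_cat /axis (negPf iz); apply: (eqc_eval2 St) => //.
rewrite row2_weyl // row2_cat row2_torus //= /act_row /=.
by congr pair; field; rewrite ?oppr_eq0 ?oner_eq0.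
Qed.

Lemma axis_pair_z k a b : k \in I -> k != z -> a != 0%R -> b != 0%R ->
  eqc (axis z a * t z k (b / a)%R) (axis k b * t k z (a / b)%R).
Proof.
move=> Ik kz a0 b0.
apply: eqc_trans (eqcMr _ (eqc_sym St (axis_z Ik kz a0))) _.
rewrite /axis (negPf kz) eval2_upper eval2_lower; apply: (eqc_eval2 St) => //.
rewrite (row2_cat (torus_word a)) (row2_cat (weyl_word b)) row2_torus // row2_weyl //=.
by rewrite /act_row /=; congr pair; field.
Qed.

(** Both sides take the basis vector z to the vector with coordinates a and b
    at i and k. If z is i or k this is a computation in SL(2); otherwise a Weyl
    element for z and i reduces to that case. *)
Lemma axis_pair i k a b : i \in I -> k \in I -> i != k -> a != 0%R -> b != 0%R ->
  eqc (axis i a * t i k (b / a)%R) (axis k b * t k i (a / b)%R).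
Proof.
move=> Ii Ik ik a0 b0; have [ez|iz] := eqVneq i z.
  by rewrite ez; apply: axis_pair_z; rewrite // eq_sym -ez.
have [ez|kz] := eqVneq k z.
  by rewrite ez; apply: (eqc_sym St); apply: axis_pair_z.
have zi : z != i by rewrite eq_sym.
have ki : k != i by rewrite eq_sym.
apply: eqc_trans (eqcMr _ (eqc_sym St (axis_weyl Ii iz a0))) _.
rewrite -mulgA (weyl_col St) // mulgA.
apply: eqc_trans (eqcMr _ (axis_pair_z Ik kz a0 b0)) _.
rewrite -mulgA (weyl_row St) // mulgA; apply: eqcMr; apply: axis_fix => //.
by apply: gen_eval2; rewrite ?Iz ?Ii // eq_sym ?ki ?kz.
Qed.

(** An element taking the basis vector z to v, when coordinate i of v is not
    zero: first to the multiple of the basis vector i, then to v by the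
    transvections of row i. *)
Definition vector_rep i (v : 'I_n -> F) : G :=
  axis i (v i) * row_elem [pred j | (j \in I) && (j != i)] i (fun j => v j / v i)%R.

Lemma vector_rep_indep i k v : i \in I -> k \in I ->
  v i != 0%R -> v k != 0%R -> eqc (vector_rep i v) (vector_rep k v).
Proof.
move=> Ii Ik vi vk; have [->|ik] := eqVneq i k; first exact: eqc_refl.
have ki : k != i by rewrite eq_sym.
rewrite /vector_rep.
rewrite (row_elem_split (k := k)) /= ?eqxx ?andbF // ?Ik //.
rewrite (@row_elem_split _ k i) /= ?eqxx ?andbF // ?Ii //.
set R := row_elem _ _ _; set R' := row_elem _ _ _.
pose J0 : pred 'I_n := [pred j | [&& j \in I, j != i & j != k]].
have RE : R = row_elem J0 i (fun j => v j / v i)%R.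
  by apply: eq_bigl => j; rewrite /J0 /= andbA.
have R'E : R' = row_elem J0 k (fun j => v j / v k)%R.
  by apply: eq_bigl => j; rewrite /J0 /= -andbA (andbC (j != k)).
have J0i : ~~ J0 i by rewrite /J0 /= eqxx andbF.
have J0k : ~~ J0 k by rewrite /J0 /= eqxx !andbF.
rewrite mulgA; apply: eqc_trans (eqcMr _ (axis_pair Ii Ik ik vi vk)) _.
rewrite -mulgA RE row_elem_swap // mulgA.
have -> : row_elem J0 k (fun j => v i / v k * (v j / v i))%R = R'.
  by rewrite R'E; apply: eq_bigr => j _; congr t; field; rewrite vi vk.
rewrite R'E row_elem_root //; apply: eqcMr; apply: axis_fix => //.
rewrite /row_elem; elim/big_rec: _ => [|j g /and3P[Ij ji jk] IH]; first exact: gen1.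
by apply: gen_cons; rewrite // ?Ii ?ik ?Ij // eq_sym.
Qed.

(** When i != l, multiplication by t k l b changes a coordinate other than i,
    and the definition of [vector_rep] through i can be used on both sides. *)
Lemma vector_rep_step i k l v b : i \in I -> k \in I -> l \in I -> k != l ->
    i != l -> v i != 0%R ->
  eqc (vector_rep i v * t k l b)
      (vector_rep i (fun j => v j + v k * b * (j == l)%:R)%R).
Proof.
move=> Ii Ik Il kl il vi; have li : l != i by rewrite eq_sym.
rewrite /vector_rep (negPf il) mulr0 addr0.
have [<-|ik] := eqVneq i k.
  rewrite -mulgA (row_elemD St) /= ?eqxx ?andbF // ?Il //.
  set A := _ * _; set B := _ * _; suff -> : A = B by exact: eqc_refl.
  by congr (_ * _); apply: eq_bigr => j _; congr t; field.
have ki : k != i by rewrite eq_sym.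
rewrite -mulgA (row_elem_comm St) /= ?eqxx ?andbF ?Ik ?Il // mulgA.
set A := row_elem _ _ _; set B := row_elem _ _ _.
have -> : A = B by apply: eq_bigr => j _; congr t; field.
by apply: eqcMr; apply: axis_fix1.
Qed.

(** The remaining case: if l is the only nonzero coordinate, t k l b fixes the
    vector. *)
Lemma vector_rep_fix l k v b : l \in I -> k \in I -> k != l -> v l != 0%R ->
    (forall j, j \in I -> j != l -> v j = 0%R) ->
  eqc (vector_rep l v * t k l b) (vector_rep l v).
Proof.
move=> Il Ik kl vl v0; rewrite /vector_rep /row_elem big1 ?mulg1; last first.
  by move=> j /andP[Ij jl]; rewrite v0 // mul0r (st0 St) // eq_sym.
exact: axis_fix1.
Qed.

End Axes.

Variable phi : G -> 'M[F]_n.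
Hypotheses (phi1 : phi 1 = 1%:M%R) (phiM : {morph phi : x y / x * y >-> (x *m y)%R})
  (phit : forall i j a, i != j -> phi (t i j a) = elem i j a).

Definition sub_rel (I : {set 'I_n}) : rel 'I_n :=
  fun i j => (i \in I) && (j \in I).

Lemma coset_of_row (I : {set 'I_n}) z m g : z \in I -> m \in I -> m != z ->
  gen (sub_rel I) g ->
  exists i, [/\ i \in I, phi g z i != 0%R & eqc t I z g (vector_rep I z m i (phi g z))].
Proof.
move=> Iz Im mz; have zm : z != m by rewrite eq_sym.
elim/gen_rind => [|h k l b [i [Ii vi e]] /andP[Ik Il] kl].
  exists z; rewrite phi1 mxE eqxx oner_eq0; split=> //.
  rewrite /vector_rep /row_elem big1 ?mulg1; last first.
    by move=> j /andP[Ij jz]; rewrite mxE eq_sym (negPf jz) mul0r (st0 St) // eq_sym.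
  rewrite mxE !eqxx /axis eqxx -(eval2_nil t z m); apply: (eqc_eval2 St) => //.
  by rewrite row2_torus // oner_eq0.
have stepE (v' := fun j => (phi h z j + phi h z k * b * (j == l)%:R)%R) j :
    phi (h * t k l b) z j = v' j by rewrite phiM phit // mul_elem.
have eqrep i' : vector_rep I z m i' (phi (h * t k l b) z) =
    vector_rep I z m i' (fun j => (phi h z j + phi h z k * b * (j == l)%:R)%R).
  rewrite /vector_rep !stepE; congr (_ * _).
  by apply: eq_bigr => j _; rewrite !stepE.
have main i' : i' \in I -> i' != l -> phi h z i' != 0%R ->
    exists i, [/\ i \in I, phi (h * t k l b) z i != 0%R &
      eqc t I z (h * t k l b) (vector_rep I z m i (phi (h * t k l b) z))].
  move=> Ii' il vi'; exists i'; split=> //.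
    by rewrite stepE (negPf il) mulr0 addr0.
  rewrite eqrep; apply: eqc_trans (vector_rep_step _ _ _ _ _ _ _ _ _ vi') => //.
  apply: eqcMr; apply: eqc_trans e _.
  by apply: vector_rep_indep.
(* Coordinate l is the one that changes, so the vector is written through
   another nonzero coordinate whenever there is one. *)
have [li|il] := eqVneq l i; last by apply: (main i); rewrite // eq_sym.
have [i' /and3P[Ii' il vi']|no] := pickP [pred j | [&& j \in I, j != l & phi h z j != 0%R]].
  exact: (main i').
have v0 j : j \in I -> j != l -> phi h z j = 0%R.
  by move=> Ij jl; have /= := no j; rewrite Ij jl /= => /negbFE/eqP.
exists i; split=> //.
  by rewrite stepE (v0 k) // !mul0r addr0.
have -> : vector_rep I z m i (phi (h * t k l b) z) = vector_rep I z m i (phi h z).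
  rewrite eqrep /vector_rep (v0 k) // !mul0r addr0; congr (_ * _).
  by apply: eq_bigr => j _; rewrite !mul0r addr0.
apply: eqc_trans (eqcMr _ e) _; rewrite -li.
by apply: vector_rep_fix => //; rewrite ?li.
Qed.

(** The stabilizer is the semidirect product of the abelian group of column z
    and of the group over the indices other than z. *)
Lemma stab_normal_form (I : {set 'I_n}) z g : gen (stab_rel I z) g ->
  exists c h, g = col_elem [pred i in I :\ z] z c * h /\ gen (sub_rel (I :\ z)) h.
Proof.
have Jz : ~~ [pred i in I :\ z] z by rewrite /= !inE eqxx.
elim=> [|i j a {}g /and3P[Ii iz Ij] ij _ [c [h [-> Rh]]]].
  exists (fun=> 0%R), 1; split; last exact: gen1.
  rewrite mulg1 /col_elem big1 // => i; rewrite /= !inE => /andP[iz _].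
  by rewrite (st0 St).
have Ji : [pred i in I :\ z] i by rewrite /= !inE iz.
rewrite mulgA; have [->|jz] := eqVneq j z.
  by eexists _, h; split; first rewrite (col_elemD St).
rewrite (col_elem_comm St) //=; last by rewrite !inE jz.
eexists _, (t i j a * h); split; first by rewrite -mulgA.
by apply: gen_cons; rewrite // /sub_rel !inE iz jz Ii.
Qed.

Lemma phi_col_elem J z c i : ~~ J z -> J i -> phi (col_elem J z c) i z = c i.
Proof.
move=> Jz Ji; have ne k : J k -> k != z.
  by move=> Jk; apply: contraNneq Jz => <-.
have iz : i != z by exact: ne.
have [_ ->] : phi (col_elem J z c) z z = 1%R /\
    phi (col_elem J z c) i z = (\sum_(k | J k) (i == k)%:R * c k)%R.
  rewrite /col_elem; elim/big_rec2: _ => [|k x g Jk [zz gE]].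
    by rewrite phi1 !mxE eqxx (negPf iz).
  rewrite phiM phit ?ne // !elem_mul zz gE [z == k]eq_sym (negPf (ne k Jk)).
  by rewrite !mulr1 !mul0r addr0 addrC.
rewrite (bigD1 i) //= big1 ?addr0 ?eqxx ?mul1r // => k /andP[_ ki].
by rewrite eq_sym (negPf ki) mul0r.
Qed.

Lemma phi_sub (I : {set 'I_n}) z g k : z \notin I -> gen (sub_rel I) g -> phi g k z = (k == z)%:R%R.
Proof.
move=> Iz Rg; elim: Rg k => [|i j a h /andP[Ii Ij] ij _ IH] k; first by rewrite phi1 mxE.
rewrite phiM phit // elem_mul !IH.
have /negPf-> : j != z by apply: contraNneq Iz => <-.
by rewrite mulr0 addr0.
Qed.

Theorem steinberg_faithful (I : {set 'I_n}) g : gen (sub_rel I) g -> phi g = 1%:M%R -> g = 1.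
Proof.
elim: {I}_.+1 {-2}I (ltnSn #|I|) g => // N IHN I leIN g Rg.
case: Rg (Rg) => // z m a g' /andP[Iz Im] zm _.
have mz : m != z by rewrite eq_sym.
move: (t _ _ _ * _) => {}g Rg pg.
have Rs : gen (stab_rel I z) g.
  have [i [Ii vi e]] := coset_of_row Iz Im mz Rg.
  have [i' [Ii' vi' e']] := coset_of_row Iz Im mz (gen1 t (sub_rel I)).
  have e1 : eqc t I z g (vector_rep I z m i' (phi g z)).
    by apply: eqc_trans e _; apply: vector_rep_indep => //; rewrite pg -phi1.
  have := eqc_trans e1 _; rewrite pg -phi1 => /(_ _ (eqc_sym St e')).
  by rewrite /eqc invg1 mulg1.
have [c [h [gE Rh]]] := stab_normal_form Rs.
have cz : col_elem [pred i in I :\ z] z c = 1.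
  rewrite /col_elem big1 // => i Ji.
  have iz : i != z by move: Ji; rewrite /= !inE => /andP[].
  suff -> : c i = 0%R by rewrite (st0 St).
  have Jz : ~~ [pred i in I :\ z] z by rewrite /= !inE eqxx.
  rewrite -(phi_col_elem c Jz Ji).
  have /(congr1 (fun A : 'M[F]_n => A i z)) := pg.
  rewrite gE phiM !mxE (negPf iz) (bigD1 z) //= big1 ?addr0.
    by rewrite (phi_sub z _ Rh) ?inE ?eqxx // mulr1.
  move=> k kz; rewrite (phi_sub k _ Rh) ?inE ?eqxx //.
  by rewrite (negPf kz) mulr0.
move: gE; rewrite cz mul1g => gE; rewrite gE; apply: IHN Rh _; last by rewrite -gE.
by move: leIN; rewrite (cardsD1 z I) Iz.
Qed.

End Faithfulness.

(** * Signed permutation matrices *)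

Section SignedPermutations.
Import GRing.Theory.
Local Open Scope ring_scope.
Variables (F : fieldType) (n : nat).
Implicit Types (A B : 'M[F]_n) (i j k l : 'I_n).

Lemma basis_sign_inj i j (s r : bool) :
  (-1) ^+ s *: 'e_i = (-1) ^+ r *: 'e_j :> 'rV[F]_n -> i = j.
Proof.
move/matrixP/(_ 0 i)/eqP; rewrite !mxE !eqxx mulr1.
by have [//|_] := eqVneq i j; rewrite mulr0 signr_eq0.
Qed.

Definition signed A : Prop := forall i, exists j (s : bool), row i A = (-1) ^+ s *: 'e_j.

Lemma signed1 : signed 1%:M.
Proof. by move=> i; exists i, false; rewrite row1 scale1r. Qed.

Lemma signed_mul A B : signed A -> signed B -> signed (A *m B).
Proof.
move=> sA sB i; have [j [s rA]] := sA i; have [k [r rB]] := sB j.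
exists k, (s (+) r); rewrite row_mul rA -scalemxAl -rowE rB scalerA.
by rewrite signr_addb.
Qed.

Lemma row_rmul A B i (s : bool) j : row i A = (-1) ^+ s *: 'e_j ->
  row i (A *m B) = (-1) ^+ s *: row j B.
Proof. by move=> rA; rewrite row_mul rA -scalemxAl -rowE. Qed.

Lemma signed_inj A i k j (s r : bool) : A \in unitmx ->
  row i A = (-1) ^+ s *: 'e_j -> row k A = (-1) ^+ r *: 'e_j -> i = k.
Proof.
move=> uA ri rk; have : ((-1) ^+ s *: 'e_i) *m A = ((-1) ^+ r *: 'e_k) *m A :> 'rV[F]_n.
  by rewrite -!scalemxAl -!rowE ri rk !scalerA -!signr_addb !addbb.
move/(congr1 (mulmx^~ (invmx A))); rewrite !mulmxK //; exact: basis_sign_inj.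
Qed.

Lemma signed_invmx A : A \in unitmx -> signed A -> signed (invmx A).
Proof.
move=> uA /fin_all_exists[f fE].
have injf : injective f.
  move=> i k e; have [s rs] := fE i; have [r rr] := fE k.
  by rewrite e in rs; exact: signed_inj rs rr.
move=> j; have [s] := fE (invF injf j); rewrite f_invF => rj.
exists (invF injf j), s; apply: (can_inj (mulmxK uA)).
rewrite -row_mul mulVmx // row1 -scalemxAl -rowE rj scalerA -signr_addb addbb.
by rewrite scale1r.
Qed.

Lemma basis_elem i k l a : 'e_i *m elem k l a = 'e_i + ((i == k)%:R * a) *: 'e_l :> 'rV[F]_n.
Proof.
by apply/rowP => j; rewrite mul_elem !mxE !eqxx /= [k == i]eq_sym.
Qed.

(** The matrix taking e_i to e_j and e_j to - e_i; written with transvections,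
    it has determinant 1 for free. *)
Definition swap_mx i j := elem i j 1 *m elem j i (-1) *m elem i j 1 : 'M[F]_n.

Lemma det_swap i j : i != j -> \det (swap_mx i j) = 1.
Proof. by move=> ij; rewrite !det_mulmx !det_elem ?mulr1 // eq_sym. Qed.

Lemma basis_elem_id i k l a : i != k -> 'e_i *m elem k l a = 'e_i :> 'rV[F]_n.
Proof. by move=> /negPf ik; rewrite basis_elem ik mul0r scale0r addr0. Qed.

Lemma basis_elem_row k l a : 'e_k *m elem k l a = 'e_k + a *: 'e_l :> 'rV[F]_n.
Proof. by rewrite basis_elem eqxx mul1r. Qed.

Lemma row_swapl i j : i != j -> row i (swap_mx i j) = 'e_j.
Proof.
move=> ij; have ji : j != i by rewrite eq_sym.
rewrite rowE !mulmxA basis_elem_row mulmxDl scale1r basis_elem_id //.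
by rewrite basis_elem_row scaleN1r addrC addrNK basis_elem_id.
Qed.

Lemma row_swapr i j : i != j -> row j (swap_mx i j) = - 'e_i.
Proof.
move=> ij; have ji : j != i by rewrite eq_sym.
rewrite rowE !mulmxA basis_elem_id // basis_elem_row mulmxDl basis_elem_id //.
by rewrite -scalemxAl basis_elem_row !scaleN1r scale1r opprD addrCA addrN addr0.
Qed.

Lemma row_swap_id i j k : k != i -> k != j -> row k (swap_mx i j) = 'e_k.
Proof. by move=> ki kj; rewrite rowE !mulmxA !basis_elem_id. Qed.

Lemma row_swap_sql i j : i != j -> row i (swap_mx i j *m swap_mx i j) = - 'e_i.
Proof. by move=> ij; rewrite row_mul row_swapl // -rowE row_swapr. Qed.

Lemma row_swap_sqr i j : i != j -> row j (swap_mx i j *m swap_mx i j) = - 'e_j.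
Proof. by move=> ij; rewrite row_mul row_swapr // mulNmx -rowE row_swapl. Qed.

Lemma signed_swap i j : i != j -> signed (swap_mx i j).
Proof.
move=> ij k; have [->|ki] := eqVneq k i.
  by exists j, false; rewrite row_swapl // scale1r.
have [->|kj] := eqVneq k j; first by exists i, true; rewrite row_swapr // scaleN1r.
by exists k, false; rewrite row_swap_id // scale1r.
Qed.

Lemma signed_col A i j (s : bool) : A \in unitmx -> signed A ->
  row i A = (-1) ^+ s *: 'e_j -> col j A = (-1) ^+ s *: delta_mx i 0.
Proof.
move=> uA sA ri; apply/colP => k; have [l [r rk]] := sA k.
rewrite !mxE eqxx andbT; have [->|ki] := eqVneq k i.
  by have /rowP/(_ j) := ri; rewrite !mxE !eqxx.
have /rowP/(_ j) := rk; rewrite !mxE eqxx /= => ->.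
have [jl|_] := eqVneq j l; last by rewrite !mulr0.
by rewrite jl in ri; case/eqP: ki; exact: signed_inj rk ri.
Qed.

(** Row j of A is e_l up to sign, and its column k is e_i up to sign, by
    [signed_col]. *)
Lemma elem_signed A i j k l (s r : bool) c : A \in unitmx -> signed A ->
    row i A = (-1) ^+ s *: 'e_k -> row j A = (-1) ^+ r *: 'e_l ->
  elem i j c *m A = A *m elem k l ((-1) ^+ (s (+) r) * c).
Proof.
move=> uA sA ri rj; rewrite /elem mulmxDl mul1mx mulmxDr mulmx1; congr (_ + _).
have deltaE u v : delta_mx u v = (delta_mx u 0 : 'cV[F]_n) *m 'e_v :> 'M[F]_n.
  by rewrite mul_delta_mx.
rewrite -scalemxAl -scalemxAr !deltaE -mulmxA -rowE rj mulmxA -colE.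
rewrite (signed_col uA sA ri) -scalemxAl -scalemxAr !scalerA signr_addb.
by congr (_ *: _); clear; case: s; case: r; rewrite /= ?expr0 ?expr1; ring.
Qed.

Lemma swap_signed A i j k l (s : bool) : A \in unitmx -> signed A ->
    row i A = (-1) ^+ s *: 'e_k -> row j A = (-1) ^+ s *: 'e_l ->
  swap_mx i j *m A = A *m swap_mx k l.
Proof.
move=> uA sA ri rj; rewrite /swap_mx -!mulmxA (elem_signed _ uA sA ri rj).
rewrite (mulmxA (elem j i _)) (elem_signed _ uA sA rj ri) !mulmxA.
by rewrite (elem_signed _ uA sA ri rj) addbb !mul1r.
Qed.

(** Signed permutations of determinant 1 are sorted by adjacent transpositions:
    the image of e_k is moved down to the place k, and two more transpositions
    correct its sign. In the last place the sign is forced by the determinant.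
    The form as an induction principle suits invariants which are only known
    to be preserved by the transpositions with indices at least k. *)
Theorem signed_ind (P : 'M[F]_n -> Prop) (k : nat) :
    P 1%:M ->
    (forall A i j, (k <= i)%N -> j = i.+1 :> nat -> P (A *m swap_mx i j) -> P A) ->
  forall A, signed A -> \det A = 1 ->
    (forall i, (i < k)%N -> row i A = 'e_i) -> P A.
Proof.
move=> P1 Pw; have [N] := ubnP (n - k).
elim: N k Pw => // N IHN k Pw ltN A sA dA fixA.
have [lenk|ltkn] := leqP n k.
  suff -> : A = 1%:M by [].
  by apply/row_matrixP => i; rewrite fixA ?row1 // (leq_trans _ lenk).
pose ko := Ordinal ltkn.
have uA B : \det B = 1 -> B \in unitmx by move=> dB; rewrite unitmxE dB unitr1.
have down B : signed B -> \det B = 1 -> (forall i, (i <= k)%N -> row i B = 'e_i) -> P B.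
  apply: (IHN k.+1); last by rewrite subnS prednK ?subn_gt0.
  by move=> C i j ki; apply: Pw; rewrite ltnW.
have detE B (s : bool) : \det B = 1 -> k.+1 = n ->
    (forall i, (i < k)%N -> row i B = 'e_i) ->
    row ko B = (-1) ^+ s *: 'e_ko -> row ko B = 'e_ko.
  move=> dB kn fixB rk; rewrite rk; move: dB.
  have entry i j : B i j = row i B 0 j by rewrite mxE.
  have lastE i : i != ko -> (i < k)%N.
    by rewrite -val_eqE /= => ik; rewrite ltn_neqAle ik /= -ltnS kn.
  rewrite det_trig; last first.
    apply/is_trig_mxP => i j ltij; rewrite entry; have [eik|/lastE ik] := eqVneq i ko.
      by move: ltij; rewrite eik ltnNge -ltnS /= kn ltn_ord.
    by rewrite fixB // mxE eqxx -val_eqE /= (gtn_eqF ltij).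
  rewrite (bigD1 ko) //= big1 => [|i /lastE ik]; last first.
    by rewrite entry fixB // mxE !eqxx.
  by rewrite entry rk !mxE !eqxx !mulr1 => ->; rewrite scale1r.
have [j [s rk]] := sA ko.
have lekj : (k <= j)%N.
  rewrite leqNgt; apply/negP => ltjk.
  have rj : row j A = (-1) ^+ false *: 'e_j by rewrite fixA ?scale1r.
  by have := signed_inj (uA _ dA) rk rj => /(congr1 val)/= e; rewrite e ltnn in ltjk.
(* Induction on the distance from the image of e_k to its place. *)
move: {2}(j - k)%N (erefl (j - k)%N) => m.
elim: m A sA dA fixA j s rk lekj => [|m IHm] A sA dA fixA j s rk lekj jk.
  have ej : j = ko by apply/val_inj/eqP; rewrite eqn_leq lekj -subn_eq0 jk.
  have plus B : signed B -> \det B = 1 -> (forall i, (i < k)%N -> row i B = 'e_i) ->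
      row ko B = 'e_ko -> P B.
    move=> sB dB fixB rB; apply: down => // i; rewrite leq_eqVlt => /orP[/eqP ik|/fixB//].
    by have -> : i = ko by exact: val_inj.
  rewrite ej in rk; have [ltk|] := ltnP k.+1 n; last first.
    rewrite leq_eqVlt ltnNge ltkn orbF => /eqP kn.
    by apply: plus => //; apply: detE rk.
  pose k1 := Ordinal ltk; have k01 : ko != k1 by rewrite -val_eqE /= ltn_eqF.
  case: s rk => rk; last by apply: plus; rewrite // rk scale1r.
  apply: (Pw A ko k1) => //; apply: (Pw _ ko k1) => //; apply: plus.
  - by do 2!apply: signed_mul _ (signed_swap k01).
  - by do 2!rewrite det_mulmx det_swap // mulr1.
  - move=> i ik; have ne : i != ko /\ i != k1.
      by rewrite -!val_eqE /= !ltn_eqF // ltnW.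
    case: ne => ne1 ne2; rewrite -mulmxA row_mul fixA // mulmxA.
    by rewrite -rowE row_swap_id // -rowE row_swap_id.
  rewrite -mulmxA (row_rmul _ rk) row_mul row_swapl // -rowE row_swapr //.
  by rewrite scaleN1r opprK.
have ltkj : (k < j)%N by rewrite -subn_gt0 jk.
have ltj1 : (j.-1 < n)%N by rewrite (leq_ltn_trans (leq_pred _)).
pose j1 := Ordinal ltj1; have jE : j = j1.+1 :> nat by rewrite /= prednK // (leq_ltn_trans _ ltkj).
have lt_neq (i l : 'I_n) : (i < l)%N -> i != l.
  by move=> il; apply: contraTneq il => ->; rewrite ltnn.
have nj : j1 != j by apply: lt_neq; rewrite [X in (_ < X)%N]jE.
have lekj1 : (k <= j1)%N by rewrite -ltnS -jE.
apply: (Pw A j1 j) => //; apply: (IHm _ _ _ _ j1 (~~ s)) => //.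
- by apply: signed_mul _ (signed_swap nj).
- by rewrite det_mulmx det_swap // mulr1.
- move=> i ik; rewrite row_mul fixA // -rowE row_swap_id //.
    exact/lt_neq/(leq_trans ik).
  exact/lt_neq/(ltn_trans ik).
- by rewrite (row_rmul _ rk) row_swapr // signrN scaleNr scalerN.
by apply/eqP; rewrite -eqSS -jk jE subSn.
Qed.

(** The sign at k absorbs the parity of s. *)
Lemma signed_of_perm (s : 'S_n) k : exists A : 'M[F]_n, [/\ signed A, \det A = 1,
  forall i, i != k -> row i A = 'e_(s i) &
  exists r : bool, row k A = (-1) ^+ r *: 'e_(s k)].
Proof.
pose d : 'rV[F]_n := \row_i (if i == k then (-1) ^+ s else 1).
have rowA i : row i (diag_mx d *m perm_mx s) = d 0 i *: 'e_(s i).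
  by apply/rowP => j; rewrite mul_diag_mx !mxE eqxx /= [j == _]eq_sym.
exists (diag_mx d *m perm_mx s); split.
- move=> i; rewrite rowA mxE; case: (i == k); first by exists (s i), s.
  by exists (s i), false; rewrite expr0.
- rewrite det_mulmx det_diag det_perm (bigD1 k) //= big1 => [|i /negPf ik].
    by rewrite mxE eqxx mulr1 -signr_addb addbb.
  by rewrite mxE ik.
- by move=> i /negPf ik; rewrite rowA mxE ik scale1r.
by exists s; rewrite rowA mxE eqxx.
Qed.

End SignedPermutations.

Lemma perm_extend (X : finType) (xs ys : seq X) :
  size xs = size ys -> uniq xs -> uniq ys -> exists s : {perm X}, map s xs = ys.
Proof.
elim: xs ys => [|x xs IH] [|y ys] //= => [_ _ _|[sz] /andP[xx ux] /andP[yy uy]].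
  by exists 1%g.
have [s sE] := IH ys sz ux uy; exists (s * tperm (s x) y)%g.
rewrite permM tpermL; congr cons; rewrite -[RHS]sE; apply/eq_in_map => z xz.
rewrite permM tpermD //; last by apply: contraNneq yy => ->; rewrite -sE map_f.
by rewrite (inj_eq perm_inj); apply: contraNneq xx => ->.
Qed.

(** * The matrices of the generators *)

Section GeneratorMatrices.
Import GRing.Theory.
Local Open Scope ring_scope.
Variables (p d : nat) (d_gt1 : (1 < d)%N).
Local Notation o1 := (inord 1 : 'I_d.-1.+1).

Lemma inord1_neq0 : ord0 != o1.
Proof. by rewrite -val_eqE /= inordK // prednK // ltnW. Qed.

Lemma tau_mxE : tau_mx p d = elem ord0 o1 1.
Proof.
have n01 := inord1_neq0.
apply/row_matrixP => i; rewrite rowK rowE; case: i => [[|i] lti] /=.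
  rewrite (_ : Ordinal lti = ord0); last exact: val_inj.
  by rewrite basis_elem_row scale1r.
by rewrite basis_elem_id.
Qed.

Lemma U_mxE : U_mx p d = swap_mx _ ord0 o1.
Proof.
have n01 := inord1_neq0; have o1E : o1 = 1%N :> nat by rewrite inordK // prednK // ltnW.
apply/row_matrixP => i; rewrite rowK; case: i => [[|[|i]] lti] /=.
- by rewrite (_ : Ordinal lti = ord0) ?row_swapl //; exact: val_inj.
- by rewrite (_ : Ordinal lti = o1) ?row_swapr //; apply: val_inj; rewrite /= o1E.
by rewrite row_swap_id // -val_eqE /= o1E.
Qed.

Lemma row_V_mx (i : 'I_d.-1.+1) : (i.+1 < d)%N ->
  row i (V_mx p d) = delta_mx 0 (inord i.+1).
Proof.
by move=> lti; rewrite rowK -val_eqE /= ifN // ltn_eqF // ltn_predRL.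
Qed.

Lemma row_V_mx_last : row ord_max (V_mx p d) = (-1) ^+ d.+1 *: delta_mx 0 ord0.
Proof. by rewrite rowK eqxx. Qed.

End GeneratorMatrices.

(** * Words and group morphisms *)

Section FreeEval.
Import GroupScope.
Local Open Scope group_scope.

Lemma free_eval_ind (X : choiceType) (gT : groupType) (g : X -> gT) (P : gT -> Prop) :
  P 1 -> (forall x y, P x -> P y -> P (x * y)) ->
  (forall i, P (g i)) -> (forall i, P (g i)^-1) ->
  forall f, P (free_eval g f).
Proof.
move=> P1 PM Pg PV f; rewrite /free_eval; elim/big_rec: _ => // a x _ Px.
by apply: PM Px; rewrite /letter_eval; case: a.2.
Qed.

Lemma eq_free_eval (X : choiceType) (gT : groupType) (g h : X -> gT) :
  g =1 h -> free_eval g =1 free_eval h.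
Proof.
by move=> gh f; rewrite /free_eval; apply: eq_bigr => a _; rewrite /letter_eval gh.
Qed.

Section GroupMorphism.
Variables (gT hT : groupType) (phi : {multiplicative gT -> hT}).

Lemma mult1 : phi 1 = 1.
Proof. by apply: (mulgI (phi 1)); rewrite -gmulfM !mulg1. Qed.

Lemma multV x : phi x^-1 = (phi x)^-1.
Proof. by apply/esym/mulg1_eq; rewrite -gmulfM mulgV mult1. Qed.

Lemma multJ x y : phi (x ^ y) = phi x ^ phi y.
Proof. by rewrite /conjg !gmulfM multV. Qed.

Lemma multX x k : phi (x ^+ k) = phi x ^+ k.
Proof. by elim: k => [|k IHk]; rewrite ?mult1 // !expgS gmulfM IHk. Qed.

End GroupMorphism.

Lemma free_eval_comp (X : choiceType) (gT hT : groupType)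
    (phi : {multiplicative gT -> hT}) (g : X -> gT) f :
  phi (free_eval g f) = free_eval (phi \o g) f.
Proof.
rewrite /free_eval (big_morph phi gmulfM (mult1 phi)); apply: eq_bigr => a _.
by rewrite /letter_eval /=; case: a.2; rewrite // multV.
Qed.

End FreeEval.

(** * Root elements of the presented group *)

Section Relations.
Import GroupScope GRing.Theory.
Local Open Scope group_scope.
Variables (p n : nat) (p_pr : prime p) (d_gt1 : (1 < n.+3)%N).
Variables (G : groupType) (T U V : G).
Local Notation F := 'F_p.

Local Notation monW := (free_eval (tnth [tuple U' p d_gt1; V' p d_gt1])).
Local Notation evalW := (free_eval (tnth [tuple U; V])).
Local Notation monS := (free_eval (tnth [tuple tau p (ltnSn 1); U' p (ltnSn 1)])).
Local Notation evalS := (free_eval (tnth [tuple T; U])).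

Hypothesis W_rel : forall f, monW f = 1 -> evalW f = 1.
Hypothesis S_rel : forall f, monS f = 1 -> evalS f = 1.
Hypothesis rel_iiia : (3 < n.+3)%N -> [~ T, U ^ (V ^+ 2)] = 1.
Hypothesis rel_iiib : (4 < n.+3)%N -> [~ T, V * U^-1 * (U^-1) ^ V] = 1.
Hypothesis rel_iva : [~ T, T ^ V] = T ^ (U ^ V).
Hypothesis rel_ivb : [~ T, T ^ (U ^ V)] = 1.
Hypothesis rel_ivc : [~ T, T ^ (U * V)] = 1.
Hypothesis rel_ivd : (3 < n.+3)%N -> [~ T, T ^ (V ^+ 2)] = 1.

Let x0 := fgen (ord0 : 'I_2).
Let x1 := fgen (ord_max : 'I_2).

Lemma evalW_x0 : evalW x0 = U. Proof. by rewrite free_eval_gen. Qed.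
Lemma evalW_x1 : evalW x1 = V. Proof. by rewrite free_eval_gen. Qed.
Lemma evalS_x0 : evalS x0 = T. Proof. by rewrite free_eval_gen. Qed.
Lemma evalS_x1 : evalS x1 = U. Proof. by rewrite free_eval_gen. Qed.

Lemma evalW1 : evalW 1 = 1. Proof. exact: gmulf1. Qed.
Lemma evalWM f g : evalW (f * g) = evalW f * evalW g. Proof. exact: gmulfM. Qed.
Lemma evalWV f : evalW f^-1 = (evalW f)^-1. Proof. exact: gmulfV. Qed.
Lemma evalWJ f g : evalW (f ^ g) = evalW f ^ evalW g. Proof. exact: gmulfJ. Qed.
Lemma evalWX f k : evalW (f ^+ k) = evalW f ^+ k. Proof. exact: gmulfXn. Qed.
Lemma evalS1 : evalS 1 = 1. Proof. exact: gmulf1. Qed.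
Lemma evalSM f g : evalS (f * g) = evalS f * evalS g. Proof. exact: gmulfM. Qed.
Lemma evalSV f : evalS f^-1 = (evalS f)^-1. Proof. exact: gmulfV. Qed.
Lemma evalSJ f g : evalS (f ^ g) = evalS f ^ evalS g. Proof. exact: gmulfJ. Qed.
Lemma evalSX f k : evalS (f ^+ k) = evalS f ^+ k. Proof. exact: gmulfXn. Qed.

Definition mxS f : 'M[F]_2 := GLval (monS f).

Lemma mxSM f g : mxS (f * g) = (mxS f *m mxS g)%R.
Proof. by rewrite /mxS gmulfM. Qed.

Lemma mxS1 : mxS 1 = 1%:M%R.
Proof. by rewrite /mxS gmulf1. Qed.

Lemma mxS_unit f : mxS f \in unitmx.
Proof. exact: (GL_unitmx (monS f)). Qed.

Lemma mxS_x0 : mxS x0 = elem ord0 ord_max 1%R.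
Proof.
have -> : mxS x0 = tau_mx p 2 by rewrite /mxS free_eval_gen.
rewrite (tau_mxE p (ltnSn 1)); congr elem.
by apply: val_inj; rewrite /= inordK.
Qed.

Lemma mxS_x1 : mxS x1 = swap_mx F ord0 ord_max.
Proof.
have -> : mxS x1 = U_mx p 2 by rewrite /mxS free_eval_gen.
rewrite (U_mxE p (ltnSn 1)); congr swap_mx.
by apply: val_inj; rewrite /= inordK.
Qed.

Lemma evalS_eq f g : mxS f = mxS g -> evalS f = evalS g.
Proof.
move=> fg; apply/divg1_eq; rewrite -evalSV -evalSM; apply: S_rel.
by rewrite gmulfF; apply/eqP; rewrite divg_eq1; apply/eqP/val_inj.
Qed.

Lemma mxSX k : mxS (x0 ^+ k) = elem ord0 ord_max k%:R%R.
Proof.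
elim: k => [|k IHk]; first by rewrite mxS1 elem0.
rewrite expgS mxSM IHk mxS_x0 (@elemD F 2 ord0 ord_max 1%R k%:R%R isT).
by congr elem; rewrite nat1r.
Qed.

Lemma mxSJ f g A : (mxS f *m mxS g = mxS g *m A)%R -> mxS (f ^ g) = A.
Proof.
move=> e; apply: (can_inj (mulKmx (mxS_unit g))).
by rewrite -mxSM -conjgC mxSM.
Qed.

Lemma T_exp_p : T ^+ p = 1.
Proof.
rewrite -evalS_x0 -evalSX -[RHS]evalS1; apply: evalS_eq.
by rewrite mxSX mxS1 pchar_Fp_0 // elem0.
Qed.

Lemma signed_mxS_x1 : signed (mxS x1).
Proof. by rewrite mxS_x1; exact: signed_swap. Qed.

Lemma mxS_lower : mxS (x0 ^ x1) = elem ord_max ord0 (-1)%R.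
Proof.
have r0 : row ord0 (mxS x1) = ((-1) ^+ false *: delta_mx 0 ord_max)%R.
  by rewrite mxS_x1 row_swapl // scale1r.
have r1 : row ord_max (mxS x1) = ((-1) ^+ true *: delta_mx 0 ord0)%R.
  by rewrite mxS_x1 row_swapr // scaleN1r.
apply: mxSJ; rewrite mxS_x0 (elem_signed _ (mxS_unit x1) signed_mxS_x1 r0 r1).
by rewrite mulr1.
Qed.

(** This ties the signed permutations to the root elements: conjugation by U can
    be computed one root element at a time. *)
Lemma U_prod : U = T * T ^ U * T.
Proof.
have : evalS x1 = evalS (x0 * x0 ^ x1 * x0).
  by apply: evalS_eq; rewrite mxSM (mxSM x0) mxS_lower mxS_x0 mxS_x1.
by rewrite 2!evalSM evalSJ evalS_x0 evalS_x1.
Qed.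

Lemma T_comm_UU : commute T (U * U).
Proof.
have r0 : row ord0 (mxS (x1 * x1)) = ((-1) ^+ true *: delta_mx 0 ord0)%R.
  by rewrite mxSM mxS_x1 row_swap_sql // scaleN1r.
have r1 : row ord_max (mxS (x1 * x1)) = ((-1) ^+ true *: delta_mx 0 ord_max)%R.
  by rewrite mxSM mxS_x1 row_swap_sqr // scaleN1r.
have sU : signed (mxS (x1 * x1)) by rewrite mxSM; apply: signed_mul; exact: signed_mxS_x1.
have : evalS (x0 * (x1 * x1)) = evalS (x1 * x1 * x0).
  apply: evalS_eq; rewrite mxSM (mxSM _ x0) mxS_x0.
  by rewrite (elem_signed _ (mxS_unit _) sU r0 r1) mulr1.
by rewrite !evalSM evalS_x0 evalS_x1.
Qed.

Local Notation N := n.+3.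
Local Notation o := (@inord n.+2).
Local Notation "''b_' k" := (delta_mx 0%R (o k%N) : 'rV[F]_N)
  (at level 8, k at level 2, format "''b_' k").

Definition mxW f : 'M[F]_N := GLval (monW f).

Lemma mxWM f g : mxW (f * g) = (mxW f *m mxW g)%R.
Proof. by rewrite /mxW gmulfM. Qed.

Lemma mxW1 : mxW 1 = 1%:M%R.
Proof. by rewrite /mxW gmulf1. Qed.

Lemma mxW_unit f : mxW f \in unitmx.
Proof. exact: (GL_unitmx (monW f)). Qed.

Lemma evalW_eq f g : mxW f = mxW g -> evalW f = evalW g.
Proof.
move=> fg; apply/divg1_eq; rewrite -evalWV -evalWM; apply: W_rel.
by rewrite gmulfF; apply/eqP; rewrite divg_eq1; apply/eqP/val_inj.
Qed.

Lemma mxWJ f g A : (mxW f *m mxW g = mxW g *m A)%R -> mxW (f ^ g) = A.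
Proof.
move=> e; apply: (can_inj (mulKmx (mxW_unit g))).
by rewrite -mxWM -conjgC mxWM.
Qed.

Lemma o_inj i j : (i < N)%N -> (j < N)%N -> i != j -> o i != o j.
Proof. by move=> iN jN; rewrite -val_eqE /= !inordK. Qed.

Lemma oK (i : 'I_N) : o i = i. Proof. exact: inord_val. Qed.

Lemma ord0_o : ord0 = o 0.
Proof. by apply: val_inj; rewrite /= inordK. Qed.

Lemma mxW_x0 : mxW x0 = swap_mx F (o 0) (o 1).
Proof.
have -> : mxW x0 = U_mx p N by rewrite /mxW free_eval_gen.
by rewrite (U_mxE p d_gt1) ord0_o.
Qed.

Lemma mxW_x1 : mxW x1 = V_mx p N.
Proof. by rewrite /mxW free_eval_gen. Qed.

Lemma row_mxW_x1 k : (k.+1 < N)%N -> row (o k) (mxW x1) = 'b_k.+1.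
Proof.
by move=> kN; rewrite mxW_x1 (@row_V_mx p N) !inordK // ltnW.
Qed.

Lemma signed_mxW f : signed (mxW f) /\ (\det (mxW f) = 1)%R.
Proof.
pose P (A : {'GL_(n.+3)(p)}) := signed (GLval A) /\ (\det (GLval A) = 1)%R.
have P1 : P 1 by split; [exact: signed1 | exact: det1].
have PM A B : P A -> P B -> P (A * B).
  move=> [sA dA] [sB dB]; split; first exact: signed_mul.
  by rewrite GL_MxE det_mulmx dA dB mulr1.
have PV A : P A -> P A^-1.
  move=> [sA dA]; have uA : GLval A \in unitmx := GL_unitmx A.
  rewrite /P GL_VxE det_inv dA invr1; split=> //; exact: signed_invmx.
have Pg i : P (tnth [tuple U' p d_gt1; V' p d_gt1] i).
  have [->|->] : i = ord0 \/ i = ord_max.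
  - by case: i => [[|[]]] // ?; [left | right]; exact: val_inj.
  - split; last exact: det_U_mx.
    have := mxW_x0; rewrite /mxW free_eval_gen => ->.
    by apply: signed_swap; apply: o_inj.
  split; last exact: det_V_mx.
  move=> k; have [kN|Nk] := ltnP k.+1 N.
    exists (o k.+1), false; have := row_mxW_x1 kN.
    by rewrite oK mxW_x1 => <-; rewrite scale1r.
  have -> : k = ord_max by apply/val_inj/eqP; rewrite eqn_leq -ltnS ltn_ord -ltnS.
  exists ord0, (odd n.+4).
  by rewrite [GLval _]/(V_mx p n.+3) row_V_mx_last signr_odd.
by apply: (free_eval_ind P1 PM Pg) => i; exact: PV.
Qed.

(** The word of the signed transposition of the basis vectors k and k + 1. *)
Definition adj k := x0 ^ (x1 ^+ k).

Lemma adj0 : adj 0 = x0. Proof. by rewrite /adj conjg1. Qed.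

Lemma adjS k : adj k.+1 = adj k ^ x1.
Proof. by rewrite /adj expgSr conjgM. Qed.

Lemma mxW_adj k : (k.+1 < N)%N -> mxW (adj k) = swap_mx F (o k) (o k.+1).
Proof.
elim: k => [|k IHk] kN; first by rewrite adj0 mxW_x0.
rewrite adjS; apply: mxWJ; rewrite IHk 1?ltnW //.
apply: (swap_signed (s := false) (mxW_unit _) (signed_mxW _).1).
  by rewrite row_mxW_x1 ?scale1r // ltnW.
by rewrite row_mxW_x1 ?scale1r.
Qed.

Lemma mxW_onto A : signed A -> (\det A = 1)%R -> exists f, mxW f = A.
Proof.
move=> sA dA; apply: (@signed_ind _ _ (fun A => exists f, mxW f = A) 0) => //.
  by exists 1; exact: mxW1.
move=> B i j _ ji [f fE]; exists (f * (adj i)^-1).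
have iN : (i.+1 < N)%N by rewrite -ji.
have := mxW_adj iN; rewrite oK -ji oK => aE.
by apply: (can_inj (mulmxK (mxW_unit (adj i)))); rewrite -mxWM mulgVK fE aE.
Qed.

(** Conjugation by b = V U^-1 (U^-1)^V moves each adjacent transposition with
    index at least 2 to the next one: V does so, and the two factors that follow
    it only involve the first three basis vectors. *)
Lemma T_comm_adj k : (1 < k)%N -> (k.+1 < N)%N -> commute T (evalW (adj k)).
Proof.
case: k => [|[|k]] // _; elim: k => [|k IHk] kN.
  rewrite /adj evalWJ evalWX evalW_x0 evalW_x1; apply/commgP/eqP.
  exact: rel_iiia.
pose b := x1 * x0^-1 * (x0^-1) ^ x1.
have Tb : commute T (evalW b).
  rewrite /b evalWM (evalWM x1) evalWJ evalWV evalW_x0 evalW_x1; apply/commgP/eqP.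
  by apply: rel_iiib; apply: leq_trans kN.
have -> : evalW (adj k.+3) = evalW (adj k.+2) ^ evalW b.
  rewrite -evalWJ; apply/esym/evalW_eq.
  have -> : b = x1 * (adj 0)^-1 * (adj 1)^-1 by rewrite adjS adj0 /b conjVg.
  rewrite 2!conjgM -adjS.
  have fix_adj h l : (l <= 1)%N -> mxW h = mxW (adj k.+3) ->
      mxW (h ^ (adj l)^-1) = mxW (adj k.+3).
    move=> l1 hE; have lN : (l.+1 < N)%N by rewrite !ltnS (leq_trans l1).
    have rowl i : (2 < i < N)%N -> row (o i) (mxW (adj l)^-1) = 'b_i.
      case/andP=> i2 iN; have li : (l.+1 < i)%N by exact: leq_ltn_trans i2.
      apply: (can_inj (mulmxK (mxW_unit (adj l)))).
      rewrite -row_mul -mxWM mulVg mxW1 row1 -rowE mxW_adj // row_swap_id //.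
        by apply: o_inj => //; [exact: ltnW | rewrite gtn_eqF // ltnW].
      by apply: o_inj; rewrite // gtn_eqF.
    apply: mxWJ; rewrite hE mxW_adj //.
    apply: (swap_signed (s := false) (mxW_unit _) (signed_mxW _).1).
      by rewrite rowl ?scale1r //= ltnW.
    by rewrite rowl ?scale1r.
  by apply: (fix_adj _ 1%N) => //; apply: fix_adj.
apply: commuteM; last apply: commuteM => //.
  by apply: commuteV.
by apply: IHk; rewrite ltnW.
Qed.

Lemma T_comm_fix f : row (o 0) (mxW f) = 'b_0 -> row (o 1) (mxW f) = 'b_1 ->
  commute T (evalW f).
Proof.
move=> r0 r1; have [sf df] := signed_mxW f.
suff: forall g, mxW g = mxW f -> commute T (evalW g) by exact.
apply: (@signed_ind _ _ (fun A => forall g, mxW g = A -> commute T (evalW g)) 2) => //.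
- move=> g g1; rewrite (@evalW_eq g 1) ?mxW1 // evalW1; exact: commute1.
- move=> B i j i2 ji IH g gE; have iN : (i.+1 < N)%N by rewrite -ji.
  have := mxW_adj iN; rewrite oK -ji oK => aE.
  have Ta := T_comm_adj i2 iN.
  rewrite -(mulgK (evalW (adj i)) (evalW g)) -evalWM; apply: commuteM.
    by apply: IH; rewrite mxWM gE aE.
  exact: commuteV.
move=> i; rewrite -(oK i) inordK //.
by case: (nat_of_ord i) => [|[|]].
Qed.

Lemma GL_conj (x y : {'GL_(n.+3)(p)}) A :
  (GLval x *m GLval y = GLval y *m A)%R -> GLval (x ^ y) = A.
Proof.
move=> e; apply: (can_inj (mulKmx (GL_unitmx y))).
by rewrite -GL_MxE -conjgC GL_MxE.
Qed.

Lemma tau_elem : GLval (tau p d_gt1) = elem (o 0) (o 1) 1%R.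
Proof.
have -> : GLval (tau p d_gt1) = tau_mx p N by [].
by rewrite (tau_mxE p d_gt1) ord0_o.
Qed.

Lemma tau_conjW f i j (a b : bool) :
  row (o 0) (mxW f) = ((-1) ^+ a *: delta_mx 0 i)%R ->
  row (o 1) (mxW f) = ((-1) ^+ b *: delta_mx 0 j)%R ->
  GLval (tau p d_gt1 ^ monW f) = elem i j ((-1) ^+ (a (+) b))%R.
Proof.
move=> f0 f1; have [sf _] := signed_mxW f; apply: GL_conj; rewrite tau_elem.
by rewrite -/(mxW f) (elem_signed _ (mxW_unit f) sf f0 f1) mulr1.
Qed.

(** In the matrix group this is the transvection attached to the images of the
    first two basis vectors. *)
Definition Tconj f : G := T ^ evalW f.

Lemma TconjM f g : Tconj (f * g) = Tconj f ^ evalW g.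
Proof. by rewrite /Tconj evalWM conjgM. Qed.

Lemma Tconj_eq f g : row (o 0) (mxW f) = row (o 0) (mxW g) ->
  row (o 1) (mxW f) = row (o 1) (mxW g) -> Tconj f = Tconj g.
Proof.
move=> r0 r1; have fixr i : row (o i) (mxW f) = row (o i) (mxW g) ->
    row (o i) (mxW (f * g^-1)) = 'b_i.
  move=> e; apply: (can_inj (mulmxK (mxW_unit g))).
  by rewrite -row_mul -mxWM mulgVK e -rowE.
rewrite -[f](mulgVK g) TconjM; congr (_ ^ _).
apply/eqP; rewrite conjg_fix; apply/eqP/eqP/commgP.
by apply: T_comm_fix; exact: fixr.
Qed.

Lemma row_sq0 f : row (o 0) (mxW (x0 * x0 * f)) = (- row (o 0) (mxW f))%R.
Proof.
by rewrite mxWM row_mul mxWM mxW_x0 row_swap_sql ?o_inj // mulNmx -rowE.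
Qed.

Lemma row_sq1 f : row (o 1) (mxW (x0 * x0 * f)) = (- row (o 1) (mxW f))%R.
Proof.
by rewrite mxWM row_mul mxWM mxW_x0 row_swap_sqr ?o_inj // mulNmx -rowE.
Qed.

(** The square of U changes both signs and commutes with T. *)
Lemma Tconj_eqN f g : row (o 0) (mxW f) = (- row (o 0) (mxW g))%R ->
  row (o 1) (mxW f) = (- row (o 1) (mxW g))%R -> Tconj f = Tconj g.
Proof.
move=> r0 r1; rewrite (@Tconj_eq f (x0 * x0 * g)) ?row_sq0 ?row_sq1 //.
rewrite TconjM /Tconj evalWM evalW_x0; congr (_ ^ _).
by apply/eqP; rewrite conjg_fix; apply/commgP/T_comm_UU.
Qed.

Let o01 : o 0 != o 1. Proof. exact: o_inj. Qed.
Let o20 : o 2 != o 0. Proof. exact: o_inj. Qed.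
Let o21 : o 2 != o 1. Proof. exact: o_inj. Qed.
Let o12 : o 1 != o 2. Proof. exact: o_inj. Qed.
Let o02 : o 0 != o 2. Proof. exact: o_inj. Qed.

Lemma row_x0_0 : row (o 0) (mxW x0) = 'b_1.
Proof. by rewrite mxW_x0 row_swapl ?o01. Qed.

Lemma row_x0_1 : row (o 1) (mxW x0) = (- 'b_0)%R.
Proof. by rewrite mxW_x0 row_swapr ?o01. Qed.

Lemma row_x0_2 : row (o 2) (mxW x0) = 'b_2.
Proof. by rewrite mxW_x0 row_swap_id ?o20 ?o21. Qed.

Lemma row_x1_0 : row (o 0) (mxW x1) = 'b_1.
Proof. exact: row_mxW_x1. Qed.

Lemma row_x1_1 : row (o 1) (mxW x1) = 'b_2.
Proof. exact: row_mxW_x1. Qed.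

Let y1 := adj 1.

Lemma row_y1_0 : row (o 0) (mxW y1) = 'b_0.
Proof. by rewrite mxW_adj // row_swap_id ?o01 // eq_sym o20. Qed.

Lemma row_y1_1 : row (o 1) (mxW y1) = 'b_2.
Proof. by rewrite mxW_adj // row_swapl ?o12. Qed.

Lemma row_y1_2 : row (o 2) (mxW y1) = (- 'b_1)%R.
Proof. by rewrite mxW_adj // row_swapr ?o12. Qed.

Lemma rowWM f g k : row k (mxW (f * g)) = (row k (mxW f) *m mxW g)%R.
Proof. by rewrite mxWM row_mul. Qed.

Let rowWE := (row_x0_0, row_x0_1, row_x0_2, row_x1_0, row_x1_1,
  row_y1_0, row_y1_1, row_y1_2).

Lemma eval_y1 : evalW y1 = U ^ V.
Proof. by rewrite /y1 adjS adj0 evalWJ evalW_x0 evalW_x1. Qed.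

(** Here x, y, z are the root elements (1,2), (2,3), (1,3), and y', z' are the
    conjugates of y and z by the change of sign of the first two basis vectors.
    Conjugating z by x * x ^ U * x, one root element at a time, gives
    y = z z' y'^-1, so y y' = z z'. This product commutes with x because z and
    z' do; but the commutator of x with y y' is z' z, so z' z = 1. *)
Lemma sign_cancel (x y z y' z' : G) : [~ x, y] = z -> [~ x, y'] = z' ->
    commute x z -> commute x z' -> commute z y' ->
  y = z ^ (x * x ^ U * x) -> y' ^ U = z -> z' ^ U = y' -> z * z' = 1.
Proof.
move=> xy xy' xz xz' zy' yE y'U z'U.
have y'x : y' ^ x = y' * z'^-1.
  by rewrite -xy' invgR commgEl mulKVg.
have zxU : z ^ (x ^ U) = z * y'^-1.
  by rewrite -{1}y'U -conjJg y'x conjMg conjVg y'U z'U.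
have zx : z ^ x = z by apply/conjg_fixP; apply/commgP/commute_sym.
have yy' : y * y' = z * z'.
  rewrite yE 2!conjgM zx zxU conjMg zx conjVg y'x invgM invgK.
  by rewrite -!mulgA mulVg mulg1.
have : [~ x, y * y'] = 1.
  by apply/eqP/commgP; rewrite yy'; exact: commuteM.
have -> : [~ x, y * y'] = [~ x, y'] * [~ x, y] ^ y'.
  by rewrite /commg /conjg !invgM !mulgA !mulgK.
rewrite xy xy' (_ : z ^ y' = z) => [e|]; last by apply/conjg_fixP/commgP.
by apply: (mulgI z'); rewrite mulg1 mulgA e mul1g.
Qed.

(** The instance of [sign_cancel] in G. Each hypothesis is a relation (iv), one
    of its conjugates, or an equality of conjugates of T read off from the images
    of the first two basis vectors. *)
Lemma TconjN : Tconj (y1 * (x0 * x0)) = (Tconj y1)^-1.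
Proof.
apply/esym/mulg1_eq.
have Tz : T ^ (U ^ V) = Tconj y1 by rewrite /Tconj eval_y1.
have Ty : T ^ V = Tconj x1 by rewrite /Tconj evalW_x1.
have T1 : T = Tconj (x0 * x0).
  by rewrite /Tconj evalWM evalW_x0; apply/esym/conjg_fixP/commgP/T_comm_UU.
have cU2 f : Tconj (f * (x0 * x0)) = Tconj f ^ (U * U).
  by rewrite TconjM evalWM evalW_x0.
have TU2 : T ^ (U * U) = T by apply/conjg_fixP/commgP/T_comm_UU.
have comm_xz : commute T (Tconj y1) by apply/commgP; rewrite -Tz rel_ivb.
apply: (@sign_cancel T (Tconj x1) _ (Tconj (x1 * (x0 * x0)))).
- by rewrite -Ty rel_iva Tz.
- by rewrite !cU2 -{1}TU2 -conjRg -Ty rel_iva Tz.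
- exact: comm_xz.
- rewrite cU2 /commute -{1 2}TU2 -!conjMg; congr (_ ^ _); exact: comm_xz.
(* (iv)(c) is about the roots (1,2) and (3,2); f moves them to (1,3) and (2,3),
   with the signs of z and y'. *)
- pose f := x0 * x0 * y1.
  have -> : Tconj y1 = Tconj f.
    by apply/esym/Tconj_eqN; rewrite ?row_sq0 ?row_sq1.
  have -> : Tconj (x1 * (x0 * x0)) = Tconj (x0 * x1 * f).
    by apply: Tconj_eq; rewrite !(rowWE, rowWM, mulNmx, =^~ rowE, opprK).
  have -> : Tconj (x0 * x1 * f) = (T ^ (U * V)) ^ evalW f.
    by rewrite TconjM /Tconj evalWM evalW_x0 evalW_x1.
  rewrite /Tconj /commute -!conjMg; congr (_ ^ _).
  exact/commgP/eqP/rel_ivc.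
- rewrite -U_prod -[in RHS]evalW_x0 -TconjM; apply: Tconj_eq;
    by rewrite !(rowWE, rowWM, mulNmx, =^~ rowE, opprK).
- rewrite -[X in _ ^ X]evalW_x0 -TconjM; apply: Tconj_eq;
    by rewrite !(rowWE, rowWM, mulNmx, =^~ rowE, opprK).
rewrite -[X in _ ^ X]evalW_x0 -TconjM; apply: Tconj_eq;
  by rewrite !(rowWE, rowWM, mulNmx, =^~ rowE, opprK).
Qed.

(** Conjugating [TconjN] back gives a word D changing exactly one of the two
    signs and inverting T. *)
Lemma Tconj_neg f g : row (o 0) (mxW f) = row (o 0) (mxW g) ->
  row (o 1) (mxW f) = (- row (o 1) (mxW g))%R -> Tconj f = (Tconj g)^-1.
Proof.
move=> r0 r1; pose D := y1 * (x0 * x0) * y1^-1.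
have DE : Tconj D = T^-1.
  rewrite /D TconjM TconjN -conjVg /Tconj -conjgM -evalWM mulgV evalW1.
  by rewrite conjg1.
have D0 : row (o 0) (mxW D) = (- 'b_0)%R.
  apply: (can_inj (mulmxK (mxW_unit y1))).
  rewrite -rowWM /D mulgVK.
  by rewrite !(rowWE, rowWM, mulNmx, =^~ rowE, opprK).
have D1 : row (o 1) (mxW D) = 'b_1.
  apply: (can_inj (mulmxK (mxW_unit y1))).
  rewrite -rowWM /D mulgVK.
  by rewrite !(rowWE, rowWM, mulNmx, =^~ rowE, opprK).
rewrite -conjVg -DE -TconjM; apply: Tconj_eqN.
  by rewrite rowWM D0 mulNmx -rowE opprK.
by rewrite rowWM D1 -rowE.
Qed.

Lemma frame_perm (s : 'S_N) : exists f r,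
  (forall k, k != o 2 -> row k (mxW f) = delta_mx 0%R (s k)) /\
  row (o 2) (mxW f) = ((-1) ^+ nat_of_bool r *: delta_mx 0 (s (o 2)))%R.
Proof.
have [A [sA dA rA [r rA2]]] := signed_of_perm F s (o 2).
by have [f fE] := mxW_onto sA dA; exists f, r; rewrite fE.
Qed.

Lemma frame_exists (i j : 'I_N) : i != j -> exists f,
  row (o 0) (mxW f) = delta_mx 0%R i /\ row (o 1) (mxW f) = delta_mx 0%R j.
Proof.
move=> ij; have [||s [s0 s1]] := @perm_extend _ [:: o 0; o 1] [:: i; j] erefl.
- by rewrite /= inE o01.
- by rewrite /= inE ij.
have [f [r [fE _]]] := frame_perm s; exists f.
by rewrite (fE _ o02) (fE _ o12) s0 s1.
Qed.

(** Some conjugate of T whose matrix is the transvection with root (i, j); all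
    of them are equal, by [Tconj_eq]. *)
Definition unit_root i j : G := Tconj (xget 1 [set f |
  row (o 0) (mxW f) = delta_mx 0%R i /\ row (o 1) (mxW f) = delta_mx 0%R j]%classic).

(** The effect on root elements of a change of sign. *)
Definition sgx (r : bool) (x : G) := if r then x^-1 else x.

Lemma Tconj_root f i j (a b : bool) : i != j ->
  row (o 0) (mxW f) = ((-1) ^+ a *: delta_mx 0 i)%R ->
  row (o 1) (mxW f) = ((-1) ^+ b *: delta_mx 0 j)%R ->
  Tconj f = sgx (a (+) b) (unit_root i j).
Proof.
move=> ij; rewrite /unit_root; case: xgetP => [g _ /= [g0 g1]|no]; last first.
  by have [g gE] := frame_exists ij; case: (no g).
case: a; case: b => /=; rewrite ?scale1r ?scaleN1r -g0 -g1 => r0 r1.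
- exact: Tconj_eqN.
- rewrite (@Tconj_eqN f (x0 * x0 * f)) ?row_sq0 ?row_sq1 ?opprK //.
  by apply: Tconj_neg; rewrite ?row_sq0 ?row_sq1 ?r0 ?r1 ?opprK.
- exact: Tconj_neg.
exact: Tconj_eq.
Qed.

Lemma Tconj_root0 f i j : i != j ->
  row (o 0) (mxW f) = delta_mx 0%R i -> row (o 1) (mxW f) = delta_mx 0%R j ->
  Tconj f = unit_root i j.
Proof.
move=> ij r0 r1; apply: (@Tconj_root f i j false false) => //.
  by rewrite r0 scale1r.
by rewrite r1 scale1r.
Qed.

Lemma sgx_commute r x y : commute x (sgx r y) -> commute x y.
Proof. by case: r => //= /commuteV; rewrite invgK. Qed.

Lemma commg_sgx r (x y z : G) : commute x z -> commute y z ->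
  [~ x, sgx r y] = sgx r z -> [~ x, y] = z.
Proof.
case: r => //= xz yz e.
have : x * y^-1 = y^-1 * x * z^-1 by rewrite commgC e.
move=> e1; have e2 : y * x = x * z^-1 * y.
  by apply: (mulIg y^-1); rewrite mulgK -mulgA e1 !mulgA mulgV mul1g.
by apply: (mulgI (y * x)); rewrite -commgC e2 -!mulgA yz mulKg.
Qed.

Lemma commg_exp (x y z : G) a b : commute x z -> commute y z ->
  [~ x, y] = z -> [~ x ^+ a, y ^+ b] = z ^+ (a * b).
Proof.
move=> xz yz xy.
have xyb : x ^ (y ^+ b) = x * z ^+ b.
  elim: b => [|b IHb]; first by rewrite conjg1 mulg1.
  have xJy : x ^ y = x * z by rewrite -xy commgEl mulKVg.
  have zJy : z ^ y = z by apply/conjg_fixP/commgP/commute_sym.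
  by rewrite expgSr conjgM IHb conjMg conjXg zJy xJy -mulgA -expgS.
rewrite commgEl conjXg xyb expgMn; last exact: commuteX.
by rewrite mulKg -expgnA mulnC.
Qed.

Lemma unit_root_exp_p i j : unit_root i j ^+ p = 1.
Proof. by rewrite /unit_root /Tconj -conjXg T_exp_p conj1g. Qed.

Lemma expg_modp (x : G) k : x ^+ p = 1 -> x ^+ (k %% p) = x ^+ k.
Proof.
by move=> xp; rewrite {2}(divn_eq k p) expgnDr mulnC expgnA xp expg1n mul1g.
Qed.

Lemma row_x1_2 : (3 < N)%N -> row (o 2) (mxW x1) = 'b_3.
Proof. exact: row_mxW_x1. Qed.

(** The third sign cannot be prescribed in general: for d = 3 it is forced by the
    determinant. This is why the relations are first proved for x and sgx r y. *)
Lemma frame3 i j k : i != j -> j != k -> i != k -> exists f r,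
  [/\ row (o 0) (mxW f) = delta_mx 0%R i, row (o 1) (mxW f) = delta_mx 0%R j &
  row (o 2) (mxW f) = ((-1) ^+ nat_of_bool r *: delta_mx 0 k)%R].
Proof.
move=> ij jk ik.
have [||s [s0 s1 s2]] := @perm_extend _ [:: o 0; o 1; o 2] [:: i; j; k] erefl.
- by rewrite /= !inE negb_or o01 o12 eq_sym o20.
- by rewrite /= !inE negb_or ij ik jk.
have [f [r [fE f2]]] := frame_perm s; exists f, r.
by rewrite (fE _ o02) (fE _ o12) s0 s1 -s2.
Qed.

Lemma commuteJ (x y g : G) : commute x y -> commute (x ^ g) (y ^ g).
Proof. by rewrite /commute -!conjMg => ->. Qed.

Lemma commTy : commute T (Tconj y1).
Proof. by rewrite /Tconj eval_y1; apply/commgP/eqP. Qed.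

Lemma unit_root_comm_row i j k : i != j -> j != k -> i != k ->
  commute (unit_root i j) (unit_root i k).
Proof.
move=> ij jk ik; have [f [r [f0 f1 f2]]] := frame3 ij jk ik.
apply: (@sgx_commute (false (+) r)).
rewrite -(Tconj_root0 ij f0 f1) -(@Tconj_root (y1 * f) i k false r ik).
- by rewrite TconjM; apply: commuteJ; exact: commTy.
- by rewrite rowWM row_y1_0 -rowE f0 scale1r.
by rewrite rowWM row_y1_1 -rowE f2.
Qed.

Lemma unit_root_comm_col i j k : i != j -> j != k -> i != k ->
  commute (unit_root i j) (unit_root k j).
Proof.
move=> ij jk ik; have [f [r [f0 f1 f2]]] := frame3 ij jk ik.
have kj : k != j by rewrite eq_sym.
apply: (@sgx_commute (r (+) true)).
rewrite -(Tconj_root0 ij f0 f1) -(@Tconj_root (x0 * x1 * f) k j r true kj).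
- rewrite TconjM; apply: commuteJ.
  by rewrite /Tconj evalWM evalW_x0 evalW_x1; apply/commgP/eqP.
- by rewrite !(rowWE, rowWM, mulNmx, =^~ rowE, opprK).
by rewrite !(rowWE, rowWM, mulNmx, =^~ rowE, opprK) f1 scaleN1r.
Qed.

Lemma unit_root_comm_disjoint i j k l : i != j -> k != l -> i != k -> i != l ->
  j != k -> j != l -> commute (unit_root i j) (unit_root k l).
Proof.
move=> ij kl ik il jk jl.
have u4 : uniq [:: i; j; k; l] by rewrite /= !inE !negb_or ij ik il jk jl kl.
have N3 : (3 < N)%N.
  by have := card_uniqP u4 => /= <-; rewrite -[X in (_ <= X)%N]card_ord max_card.
have u4' : uniq [:: o 0; o 1; o 2; o 3].
  by rewrite /= !inE !negb_or !o_inj.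
have [s [s0 s1 s2 s3]] :=
  @perm_extend _ [:: o 0; o 1; o 2; o 3] [:: i; j; k; l] erefl u4' u4.
have [f [r [fE f2]]] := frame_perm s.
have f0 : row (o 0) (mxW f) = delta_mx 0%R i by rewrite fE ?s0 // o_inj.
have f1 : row (o 1) (mxW f) = delta_mx 0%R j by rewrite fE ?s1 // o_inj.
have f3 : row (o 3) (mxW f) = delta_mx 0%R l by rewrite fE ?s3 // o_inj.
apply: (@sgx_commute (r (+) false)).
rewrite -(Tconj_root0 ij f0 f1) -(@Tconj_root (x1 * x1 * f) k l r false kl).
- rewrite TconjM; apply: commuteJ.
  by rewrite /Tconj evalWM evalW_x1; apply/commgP/eqP/rel_ivd.
- by rewrite !(rowWE, rowWM, =^~ rowE) f2 s2.
by rewrite !(rowWE, rowWM, row_x1_2, =^~ rowE) // f3 scale1r.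
Qed.

Lemma unit_root_commutator i j k : i != j -> j != k -> i != k ->
  [~ unit_root i j, unit_root j k] = unit_root i k.
Proof.
move=> ij jk ik; have [f [r [f0 f1 f2]]] := frame3 ij jk ik.
have kj : k != j by rewrite eq_sym.
have ki : k != i by rewrite eq_sym.
apply: (@commg_sgx (false (+) r)).
- exact: unit_root_comm_row.
- by apply: unit_root_comm_col; rewrite // eq_sym.
rewrite -(Tconj_root0 ij f0 f1) -(@Tconj_root (x1 * f) j k false r jk).
- rewrite -(@Tconj_root (y1 * f) i k false r ik).
  + have Txy : [~ T, Tconj x1] = Tconj y1.
      by rewrite /Tconj eval_y1 evalW_x1 rel_iva.
    by rewrite (TconjM x1) (TconjM y1) -Txy conjRg.
  + by rewrite rowWM row_y1_0 -rowE f0 scale1r.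
  by rewrite rowWM row_y1_1 -rowE f2.
- by rewrite rowWM row_x1_0 -rowE f1 scale1r.
by rewrite rowWM row_x1_1 -rowE f2.
Qed.

Definition root_elem i j (a : F) : G := unit_root i j ^+ a.

Lemma val_FpD (a b : F) : (a + b)%R = ((a + b) %% p)%N :> nat.
Proof. exact: (congr1 (modn _) (Fp_cast p_pr)). Qed.

Lemma val_FpM (a b : F) : (a * b)%R = ((a * b) %% p)%N :> nat.
Proof. exact: (congr1 (modn _) (Fp_cast p_pr)). Qed.

(** The translation of a word in root elements of SL(2) into the generators tau
    and U'. *)
Definition word_S (w : seq (bool * F)) : freeGroup (ordinal 2) :=
  \prod_(l <- w) (if l.1 then x0 ^+ l.2 else (x0 ^ x1)^-1 ^+ l.2).

Lemma mxS_upper (a : F) : mxS (x0 ^+ a) = elem ord0 ord_max a.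
Proof. by rewrite mxSX natr_Zp. Qed.

Lemma mxS_lower_exp (a : F) : mxS ((x0 ^ x1)^-1 ^+ a) = elem ord_max ord0 a.
Proof.
have ne : (ord_max : 'I_2) != ord0 by [].
have E : mxS (x0 ^ x1)^-1 = elem ord_max ord0 1%R.
  apply: (can_inj (mulKmx (mxS_unit (x0 ^ x1)))).
  by rewrite -mxSM mulgV mxS1 mxS_lower (@elemD F 2 _ _ _ _ ne) addNr elem0.
suff E' k : mxS ((x0 ^ x1)^-1 ^+ k) = elem ord_max ord0 k%:R%R by rewrite E' natr_Zp.
elim: k => [|k IHk]; first by rewrite mxS1 elem0.
by rewrite expgS mxSM IHk E (@elemD F 2 _ _ _ _ ne) nat1r.
Qed.

Lemma mxS_word w : mxS (word_S w) = mx2 w.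
Proof.
rewrite /word_S; elim: w => [|l w IHw]; first by rewrite big_nil mxS1 mx2_nil.
rewrite big_cons mxSM IHw mx2_cons; congr (_ *m _)%R.
by case: l => [[] a]; rewrite ?mxS_upper ?mxS_lower_exp.
Qed.

Lemma root_elem_rank2 i j w : i != j -> mx2 w = 1%R -> eval2 root_elem i j w = 1.
Proof.
move=> ij w1; have [f [f0 f1]] := frame_exists ij.
have ji : j != i by rewrite eq_sym.
have -> : eval2 root_elem i j w = evalS (word_S w) ^ evalW f.
  elim: w {w1} => [|l w IHw].
    by rewrite eval2_nil /word_S big_nil evalS1 conj1g.
  rewrite eval2_cons IHw /word_S big_cons evalSM conjMg; congr (_ * _).
  rewrite /root_elem; case: l => [[] a] /=.
    by rewrite evalSX conjXg evalS_x0 -(Tconj_root0 ij f0 f1).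
  have rji : (T ^ U) ^ evalW f = (unit_root j i)^-1.
    rewrite -[X in T ^ X]evalW_x0 -conjgM -evalWM -/(Tconj _).
    rewrite (@Tconj_root _ j i false true ji) //.
      by rewrite rowWM row_x0_0 -rowE f1 scale1r.
    by rewrite rowWM row_x0_1 mulNmx -rowE f0 scaleN1r.
  by rewrite evalSX conjXg evalSV conjVg evalSJ evalS_x0 evalS_x1 rji invgK.
have -> : evalS (word_S w) = 1.
  by rewrite -evalS1; apply: evalS_eq; rewrite mxS_word w1 mxS1.
by rewrite conj1g.
Qed.

Theorem root_elem_steinberg : steinberg_relations root_elem.
Proof.
split=> [i j a b ij|i j k a b ij jk ik|i j k l a b ij kl jk il|].
- by rewrite /root_elem -expgnDr val_FpD expg_modp // unit_root_exp_p.
- rewrite /root_elem val_FpM expg_modp ?unit_root_exp_p //; apply: commg_exp.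
  + exact: unit_root_comm_row.
  + by apply: unit_root_comm_col; rewrite // eq_sym.
  exact: unit_root_commutator.
- apply: commuteX2; have [<-|ik] := eqVneq i k.
    have [<-|jl] := eqVneq j l; first exact: commute_refl.
    exact: unit_root_comm_row.
  have [<-|jl] := eqVneq j l; last exact: unit_root_comm_disjoint.
  by apply: unit_root_comm_col; rewrite // eq_sym.
exact: root_elem_rank2.
Qed.

Local Notation gen := (gen root_elem (sub_rel [set: 'I_N])).

Lemma gen_Tconj f : gen (Tconj f).
Proof.
have [sf _] := signed_mxW f; have [i [a f0]] := sf (o 0); have [j [b f1]] := sf (o 1).
have ij : i != j.
  apply: contraTneq o01 => e; rewrite -e in f1.
  by rewrite (signed_inj (mxW_unit f) f0 f1) eqxx.
have g1 : gen (unit_root i j).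
  have -> : unit_root i j = root_elem i j 1%R by [].
  by apply: gen_root; rewrite // /sub_rel !inE.
rewrite (Tconj_root ij f0 f1); case: (a (+) b) => //=.
exact: (gen_inv root_elem_steinberg).
Qed.

Lemma gen_T : gen T.
Proof. by have := gen_Tconj 1; rewrite /Tconj evalW1 conjg1. Qed.

Lemma gen_adj k : gen (evalW (adj k)).
Proof.
pose w := x1 ^+ k.
have -> : evalW (adj k) = Tconj w * Tconj (x0 * w) * Tconj w.
  rewrite (TconjM x0) /adj evalWJ evalW_x0 {1}U_prod 2!conjMg /Tconj.
  by rewrite evalW_x0.
by apply: gen_mul; [apply: gen_mul|]; exact: gen_Tconj.
Qed.

Lemma gen_evalW f : gen (evalW f).
Proof.
have [sf df] := signed_mxW f.
apply: (@signed_ind _ _ (fun A => forall g, mxW g = A -> gen (evalW g)) 0 _ _ _ sf df) => //.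
- by move=> g g1; rewrite (@evalW_eq g 1) ?mxW1 // evalW1; exact: gen1.
move=> B i j _ ji IH g gE; have iN : (i.+1 < N)%N by rewrite -ji.
have := mxW_adj iN; rewrite oK -ji oK => aE.
rewrite -(mulgK (evalW (adj i)) (evalW g)) -evalWM; apply: gen_mul.
  by apply: IH; rewrite mxWM gE aE.
exact: (gen_inv root_elem_steinberg (gen_adj i)).
Qed.

Variable phi : {multiplicative G -> {'GL_(n.+3)(p)}}.
Hypotheses (phiT : phi T = tau p d_gt1) (phiU : phi U = U' p d_gt1)
  (phiV : phi V = V' p d_gt1).

Lemma phi_evalW f : phi (evalW f) = monW f.
Proof.
rewrite free_eval_comp; apply: eq_free_eval => i /=.
by case: i => [[|[]]] // lti; rewrite !(tnth_nth 1) /= ?phiU ?phiV.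
Qed.

Lemma GL_elem_exp (x : {'GL_(n.+3)(p)}) i j k : i != j ->
  GLval x = elem i j 1%R -> GLval (x ^+ k) = elem i j k%:R%R.
Proof.
move=> ij xE; elim: k => [|k IHk]; first by rewrite elem0.
by rewrite expgS GL_MxE IHk xE (@elemD F _ _ _ _ _ ij) nat1r.
Qed.

Lemma phi_root i j a : i != j -> GLval (phi (root_elem i j a)) = elem i j a.
Proof.
move=> ij; rewrite /root_elem multX -[in RHS](natr_Zp a).
apply: GL_elem_exp => //; have [f [f0 f1]] := frame_exists ij.
rewrite -(Tconj_root0 ij f0 f1) /Tconj multJ phiT phi_evalW.
rewrite (@tau_conjW f i j false false) ?f0 ?f1 ?scale1r //.
Qed.

Hypothesis generated : forall P : G -> Prop, P T -> P U -> P V ->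
  P 1 -> (forall x y, P x -> P y -> P (x * y)) -> (forall x, P x -> P x^-1) ->
  forall g, P g.

Lemma gen_all g : gen g.
Proof.
apply: generated.
- exact: gen_T.
- by rewrite -evalW_x0; exact: gen_evalW.
- by rewrite -evalW_x1; exact: gen_evalW.
- exact: gen1.
- exact: gen_mul.
exact: (gen_inv root_elem_steinberg).
Qed.

Theorem phi_faithful g : phi g = 1 -> g = 1.
Proof.
move=> g1; apply: (@steinberg_faithful _ _ _ _ root_elem_steinberg
  (fun x => GLval (phi x)) _ _ phi_root _ _ (gen_all g)).
- by rewrite mult1.
- by move=> x y; rewrite gmulfM.
by rewrite g1.
Qed.

Theorem phi_onto (A : 'M[F]_N) : (\det A = 1)%R -> exists g, GLval (phi g) = A.
Proof.
move=> dA; apply: (@SL_elementary _ _ (fun A => exists g, GLval (phi g) = A)) dA.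
- by exists 1; rewrite mult1.
- move=> B i j a ij [g gE]; exists (g * (root_elem i j a)^-1).
  apply: (can_inj (mulmxK (GL_unitmx (phi (root_elem i j a))))).
  by rewrite -GL_MxE -gmulfM mulgVK gE -(phi_root a ij).
move=> B i j a ij [g gE]; exists ((root_elem i j a)^-1 * g).
apply: (can_inj (mulKmx (GL_unitmx (phi (root_elem i j a))))).
by rewrite -GL_MxE -gmulfM mulVKg gE -(phi_root a ij).
Qed.

End Relations.

(** * The relations hold for matrices *)

Section MatrixRelations.
Import GroupScope GRing.Theory.
Local Open Scope group_scope.
Variables (p n : nat) (d_gt1 : (1 < n.+3)%N).
Local Notation F := 'F_p.
Local Notation N := n.+3.
Local Notation o := (@inord n.+2).
Local Notation t := (tau p d_gt1).
Local Notation u := (U' p d_gt1).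
Local Notation v := (V' p d_gt1).
Local Notation monW := (free_eval (tnth [tuple u; v])).
Let x0 := fgen (ord0 : 'I_2).
Let x1 := fgen (ord_max : 'I_2).

Let monW0 : monW x0 = u. Proof. by rewrite free_eval_gen. Qed.
Let monW1 : monW x1 = v. Proof. by rewrite free_eval_gen. Qed.

Let monWM f g : monW (f * g) = monW f * monW g. Proof. exact: gmulfM. Qed.
Let monWV f : monW f^-1 = (monW f)^-1. Proof. exact: gmulfV. Qed.
Let monWJ f g : monW (f ^ g) = monW f ^ monW g. Proof. exact: gmulfJ. Qed.
Let monWX f k : monW (f ^+ k) = monW f ^+ k. Proof. exact: gmulfXn. Qed.

Lemma monW_adj k : monW (adj k) = u ^ (v ^+ k).
Proof. by rewrite /adj monWJ monWX monW0 monW1. Qed.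

Lemma tau_conj_adj1 : GLval (t ^ (u ^ v)) = elem (o 0) (o 2) 1%R.
Proof.
have := monW_adj 1; rewrite expg1 => <-.
by rewrite (@tau_conjW p n d_gt1 _ (o 0) (o 2) false false)
  ?row_y1_0 ?row_y1_1 ?scale1r.
Qed.

Lemma tau_conj_V : GLval (t ^ v) = elem (o 1) (o 2) 1%R.
Proof.
rewrite -monW1 (@tau_conjW p n d_gt1 _ (o 1) (o 2) false false)
  ?row_x1_0 ?row_x1_1 ?scale1r //.
Qed.

Lemma tau_fix f : row (o 0) (mxW p d_gt1 f) = delta_mx 0%R (o 0) ->
  row (o 1) (mxW p d_gt1 f) = delta_mx 0%R (o 1) -> [~ t, monW f] = 1.
Proof.
move=> f0 f1; have e : GLval (t ^ monW f) = GLval t.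
  by rewrite (@tau_conjW p n d_gt1 f (o 0) (o 1) false false) ?f0 ?f1 ?scale1r
    ?tau_elem.
by apply/eqP/conjg_fixP; exact: val_inj e.
Qed.

Lemma GL_commute (x y : {'GL_N(p)}) :
  (GLval x *m GLval y = GLval y *m GLval x)%R -> [~ x, y] = 1.
Proof. by move=> e; apply/eqP/commgP/val_inj. Qed.

Let o01 : o 0 != o 1. Proof. exact: o_inj. Qed.
Let o12 : o 1 != o 2. Proof. exact: o_inj. Qed.
Let o02 : o 0 != o 2. Proof. exact: o_inj. Qed.

Lemma matrix_rel_iiia : (3 < N)%N -> [~ t, u ^ (v ^+ 2)] = 1.
Proof.
move=> N3; rewrite -monW_adj; apply: tau_fix; rewrite mxW_adj // row_swap_id //;
  exact: o_inj.
Qed.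

Lemma matrix_rel_iiib : [~ t, v * u^-1 * (u^-1) ^ v] = 1.
Proof.
pose b := x1 * (adj 0)^-1 * (adj 1)^-1.
have <- : monW b = v * u^-1 * (u^-1) ^ v.
  by rewrite /b monWM (monWM x1) !monWV !monW_adj monW1 conjg1 conjVg expg1.
have bE : b * adj 1 * adj 0 = x1 by rewrite /b mulgVK mulgVK.
have inj1 := can_inj (mulmxK (mxW_unit p d_gt1 (adj 1))).
have inj0 := can_inj (mulmxK (mxW_unit p d_gt1 (adj 0))).
apply: tau_fix; apply: (inj1); apply: (inj0); rewrite -!rowWM bE.
  by rewrite row_x1_0 -rowE row_y1_0 -rowE adj0 row_x0_0.
by rewrite row_x1_1 -rowE row_y1_1 -rowE adj0 row_x0_2.
Qed.

Lemma matrix_rel_iva : [~ t, t ^ v] = t ^ (u ^ v).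
Proof.
apply: (mulgI (t ^ v * t)); rewrite -commgC; apply: val_inj.
rewrite -[LHS]/(GLval t *m GLval (t ^ v))%R.
rewrite -[RHS]/(GLval (t ^ v) *m GLval t *m GLval (t ^ (u ^ v)))%R.
rewrite tau_elem tau_conj_V tau_conj_adj1 -[X in elem (o 0) (o 2) X](mulr1 1%R).
exact: elem_commutator.
Qed.

Lemma matrix_rel_ivb : [~ t, t ^ (u ^ v)] = 1.
Proof.
apply: GL_commute; rewrite tau_elem tau_conj_adj1.
by apply: elem_commute; rewrite // eq_sym.
Qed.

Lemma matrix_rel_ivc : [~ t, t ^ (u * v)] = 1.
Proof.
apply: GL_commute; rewrite tau_elem.
have -> : u * v = monW (x0 * x1) by rewrite monWM monW0 monW1.
rewrite (@tau_conjW p n d_gt1 _ (o 2) (o 1) false true).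
- by apply: elem_commute.
- by rewrite rowWM row_x0_0 -rowE row_x1_1 scale1r.
by rewrite rowWM row_x0_1 mulNmx -rowE row_x1_0 scaleN1r.
Qed.

Lemma matrix_rel_ivd : (3 < N)%N -> [~ t, t ^ (v ^+ 2)] = 1.
Proof.
move=> N3; apply: GL_commute; rewrite tau_elem.
have -> : v ^+ 2 = monW (x1 * x1) by rewrite monWM monW1.
rewrite (@tau_conjW p n d_gt1 _ (o 2) (o 3) false false).
- by apply: elem_commute; rewrite // o_inj.
- by rewrite rowWM row_x1_0 -rowE row_x1_1 scale1r.
by rewrite rowWM row_x1_1 -rowE row_x1_2 // scale1r.
Qed.

End MatrixRelations.

Section Corner.
Import GRing.Theory.
Local Open Scope ring_scope.
Variables (F : fieldType) (n m : nat) (w : 'I_n -> 'I_m).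
Hypothesis w_inj : injective w.

(** The extension of A by the identity outside the image of w, written with the
    inclusion matrix J so that multiplicativity follows from J J^T = 1. *)
Definition corner (A : 'M[F]_n) : 'M[F]_m :=
  let J := \matrix_(i, j) (w i == j)%:R in 1%:M + J^T *m (A - 1%:M) *m J.

Lemma cornerM A B : corner (A *m B) = corner A *m corner B.
Proof.
rewrite /corner; set J := \matrix_(_, _) _.
have JJ : J *m J^T = 1%:M.
  apply/matrixP => i j; rewrite mxE (bigD1 (w i)) //= big1 => [|k /negPf ki].
    by rewrite !mxE eqxx mul1r addr0 (inj_eq w_inj) eq_sym.
  by rewrite !mxE [w i == k]eq_sym ki mul0r.
have AB : A *m B - 1%:M = (A - 1%:M) + (B - 1%:M) + (A - 1%:M) *m (B - 1%:M).
  rewrite mulmxBr mulmx1 mulmxBl mul1mx [A - _ + _]addrC -addrA.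
  by rewrite [A - _ + _]addrC subrK addrC addrA subrK.
rewrite AB; move: (A - 1%:M) (B - 1%:M) => a b.
rewrite !(mulmxDr, mulmxDl) !mul1mx !mulmx1 -!addrA; congr (_ + _).
rewrite addrA addrCA -!addrA addrCA; congr (_ + (_ + _)).
by rewrite -!mulmxA (mulmxA J) JJ mul1mx.
Qed.

Lemma corner1 : corner 1%:M = 1%:M.
Proof. by rewrite /corner subrr mulmx0 mul0mx addr0. Qed.

Lemma corner_elem i j c : corner (elem i j c) = elem (w i) (w j) c.
Proof.
rewrite /corner /elem [_ + _ - _]addrC addKr; congr (_ + _).
rewrite -scalemxAr -scalemxAl; congr (_ *: _); apply/matrixP => k l.
rewrite mxE (bigD1 j) //= big1 => [|h hj]; last first.
  rewrite [(_ *m delta_mx i j) _ _]mxE big1 ?mul0r // => g _.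
  by rewrite [delta_mx _ _ _ _]mxE (negPf hj) andbF mulr0.
rewrite [(_ *m delta_mx i j) _ _]mxE (bigD1 i) //= big1 => [|h hi]; last first.
  by rewrite [delta_mx _ _ _ _]mxE (negPf hi) mulr0.
rewrite !mxE !eqxx !addr0 mulr1 -natrM mulnb.
by rewrite [k == _]eq_sym [l == _]eq_sym.
Qed.

Lemma corner_swap i j : corner (swap_mx F i j) = swap_mx F (w i) (w j).
Proof. by rewrite /swap_mx !cornerM !corner_elem. Qed.

End Corner.

Section CornerWords.
Import GroupScope GRing.Theory.
Local Open Scope group_scope.
Variables (p n : nat) (d_gt1 : (1 < n.+3)%N).
Local Notation o := (@inord n.+2).

(** The relations of (ii) are those of 2 x 2 matrices; they pass to SL(d)
    through the upper left corner. *)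
Lemma corner_word f :
  free_eval (tnth [tuple tau p (ltnSn 1); U' p (ltnSn 1)]) f = 1 ->
  free_eval (tnth [tuple tau p d_gt1; U' p d_gt1]) f = 1.
Proof.
pose w (i : 'I_2) : 'I_n.+3 := o i.
have w_inj : injective w.
  move=> i j /(congr1 val); rewrite /= !inordK ?(leq_trans (ltn_ord _)) //.
  exact: val_inj.
have w0 : w ord0 = o 0 by [].
have w1 : w ord_max = o 1 by [].
suff cE : GLval (free_eval (tnth [tuple tau p d_gt1; U' p d_gt1]) f) =
    corner w (GLval (free_eval (tnth [tuple tau p (ltnSn 1); U' p (ltnSn 1)]) f)).
  by move=> f1; apply: val_inj; rewrite f1 in cE; apply: etrans cE (corner1 _ w).
rewrite /free_eval; elim/big_rec2: _ => [|a x y _ xy]; first by rewrite corner1.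
rewrite !GL_MxE cornerM // xy; congr (_ *m _)%R.
have gE i : GLval (tnth [tuple tau p d_gt1; U' p d_gt1] i) =
    corner w (GLval (tnth [tuple tau p (ltnSn 1); U' p (ltnSn 1)] i)).
  have [->|->] : i = ord0 \/ i = ord_max.
  - by case: i => [[|[]]] // ?; [left | right]; exact: val_inj.
  - have := mxS_x0 p d_gt1; rewrite /mxS free_eval_gen => ->.
    by rewrite corner_elem w0 w1 -(tau_elem p d_gt1).
  have := mxS_x1 p d_gt1; rewrite /mxS free_eval_gen => ->.
  rewrite corner_swap // w0 w1 -(mxW_x0 p d_gt1) /mxW free_eval_gen.
  by [].
rewrite /letter_eval; case: a.2; first exact: gE.
set g := tnth _ a.1; set h := tnth _ a.1.
have ghE : GLval g = corner w (GLval h) by exact: gE.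
have gh1 : (GLval g *m corner w (GLval (h^-1)%g) = 1%:M)%R.
  have hV : (GLval h *m GLval (h^-1)%g = 1%:M)%R := congr1 (@GLval 2 _) (mulgV h).
  by rewrite ghE -cornerM // hV corner1.
apply: (can_inj (mulKmx (GL_unitmx g))); rewrite -GL_MxE mulgV; exact: esym.
Qed.

End CornerWords.

(** * Presented groups *)

Section Presentations.
Import GroupScope.
Local Open Scope group_scope.

Lemma kernel_nclosure (G H : groupType) (phi : {multiplicative G -> H})
    (R : set G) : (forall r, R r -> phi r = 1) ->
  forall f, nclosure R f -> phi f = 1.
Proof.
move=> phiR f Rf; apply: (Rf [set x | phi x = 1]%classic); split=> //.
split=> /= [|x y x1 y1|x x1|x y x1]; first exact: mult1.
- by rewrite gmulfM x1 y1 mulg1.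
- by rewrite multV x1 invg1.
by rewrite multJ x1 conj1g.
Qed.

Lemma free_word_prod (X : choiceType) (f : freeGroup X) :
  free_eval (fun x => fgen x) f = f.
Proof.
case: f => w rw; apply: val_inj; rewrite /free_eval /=.
elim: w rw => [|a w IHw] raw; first by rewrite big_nil.
have rw : reduced w by exact: path_sorted raw.
have mulE (x y : freeGroup X) :
  free_word (x * y) = foldr (@Defs.free_cons X) (free_word y) (free_word x) by [].
rewrite big_cons mulE IHw //.
have -> : free_word (letter_eval (fun x => fgen x) a) = [:: a].
  by case: a {raw} => x [].
by case: w raw {IHw rw} => //= b w /andP[/negPf->].
Qed.

Section Quotient.
Variables (X : choiceType) (R : set (freeGroup X)).
Local Notation Q := (presentedGroup R).

Definition presented_pi (f : freeGroup X) : Q := (\pi_Q f)%qT.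

Lemma presented_piM : {morph presented_pi : x y / x * y}.
Proof. by move=> x y; exact: pi_quotM. Qed.

HB.instance Definition _ :=
  isMultiplicative.Build (freeGroup X) Q presented_pi presented_piM.

Lemma presented_pi_rel r : R r -> presented_pi r = 1.
Proof.
move=> Rr; apply/esym/(pi_quotP (nclosure_normal R)); rewrite invg1 mul1g.
by move=> N [_ sRN]; exact: sRN.
Qed.

Lemma presented_pi_repr (x : Q) : presented_pi (generic_quotient.repr x) = x.
Proof. exact: reprK. Qed.

Variables (H : groupType) (phi : {multiplicative freeGroup X -> H}).
Hypothesis phiR : forall r, R r -> phi r = 1.

Definition presented_lift (x : Q) : H := phi (generic_quotient.repr x).

Lemma presented_liftE f : presented_lift (presented_pi f) = phi f.
Proof.
have /(kernel_nclosure phiR) := ncong_repr (nclosure_normal R) f.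
by rewrite gmulfM multV => /mulg1_eq; rewrite invgK.
Qed.

Lemma presented_liftM : {morph presented_lift : x y / x * y}.
Proof.
move=> x y; rewrite -[x]presented_pi_repr -[y]presented_pi_repr.
by rewrite -gmulfM !presented_liftE gmulfM.
Qed.

End Quotient.
End Presentations.

(** * The isomorphism *)

Section MainProof.
Import GroupScope GRing.Theory.
Local Open Scope group_scope.
Variables (p n : nat) (p_pr : prime p) (d_gt1 : (1 < n.+3)%N).
Variables (R1 R2 : set (freeGroup 'I_2)).
Hypotheses (R1P : presents R1 [tuple U' p d_gt1; V' p d_gt1])
  (R2P : presents R2 [tuple tau p (ltnSn 1); U' p (ltnSn 1)]).

Local Notation rels := (relators n.+3 R1 R2).
Local Notation G := (presentedGroup rels).
Local Notation pi := (@presented_pi _ rels).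
Let gt := fgen (inord 0 : 'I_3).
Let gu := fgen (inord 1 : 'I_3).
Let gv := fgen (inord 2 : 'I_3).
Let T : G := pi gt.
Let U : G := pi gu.
Let V : G := pi gv.

Let piM f g : pi (f * g) = pi f * pi g. Proof. exact: gmulfM. Qed.
Let piV f : pi f^-1 = (pi f)^-1. Proof. exact: multV. Qed.
Let piJ f g : pi (f ^ g) = pi f ^ pi g. Proof. exact: multJ. Qed.
Let piX f k : pi (f ^+ k) = pi f ^+ k. Proof. exact: multX. Qed.
Let piR f g : pi [~ f, g] = [~ pi f, pi g].
Proof. by rewrite /commg piM piV piJ. Qed.

Let rel1 f : free_eval (tnth [tuple U' p d_gt1; V' p d_gt1]) f = 1 ->
  free_eval (tnth [tuple U; V]) f = 1.
Proof.
move=> f1; have Rf : nclosure R1 f by rewrite R1P.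
apply: (kernel_nclosure (phi := free_eval (tnth [tuple U; V])) _ Rf) => r Rr.
have : pi (free_eval (tnth [tuple gu; gv]) r) = 1.
  by apply: presented_pi_rel; left; left; left; exists r.
rewrite free_eval_comp; apply: etrans; apply: eq_free_eval => i /=.
by case: i => [[|[]]] // lti; rewrite !(tnth_nth 1).
Qed.

Let rel2 f : free_eval (tnth [tuple tau p (ltnSn 1); U' p (ltnSn 1)]) f = 1 ->
  free_eval (tnth [tuple T; U]) f = 1.
Proof.
move=> f1; have Rf : nclosure R2 f by rewrite R2P.
apply: (kernel_nclosure (phi := free_eval (tnth [tuple T; U])) _ Rf) => r Rr.
have : pi (free_eval (tnth [tuple gt; gu]) r) = 1.
  by apply: presented_pi_rel; left; left; right; exists r.
rewrite free_eval_comp; apply: etrans; apply: eq_free_eval => i /=.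
by case: i => [[|[]]] // lti; rewrite !(tnth_nth 1).
Qed.

Let rel_iiia : (3 < n.+3)%N -> [~ T, U ^ (V ^+ 2)] = 1.
Proof.
move=> N3; have : pi [~ gt, gu ^ (gv ^+ 2)] = 1.
  by apply: presented_pi_rel; left; right; left.
by rewrite piR piJ piX.
Qed.

Let rel_iiib : (4 < n.+3)%N -> [~ T, V * U^-1 * (U^-1) ^ V] = 1.
Proof.
move=> N4; have : pi [~ gt, gv * gu^-1 * (gu^-1) ^ gv] = 1.
  by apply: presented_pi_rel; left; right; right.
by rewrite piR piM (piM gv) piJ piV.
Qed.

Let rel_iva : [~ T, T ^ V] = T ^ (U ^ V).
Proof.
have : pi ([~ gt, gt ^ gv] * (gt ^ (gu ^ gv))^-1) = 1.
  by apply: presented_pi_rel; right; left; left; left.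
by rewrite piM piV piR !piJ => /divg1_eq.
Qed.

Let rel_ivb : [~ T, T ^ (U ^ V)] = 1.
Proof.
have : pi [~ gt, gt ^ (gu ^ gv)] = 1.
  by apply: presented_pi_rel; right; left; left; right.
by rewrite piR !piJ.
Qed.

Let rel_ivc : [~ T, T ^ (U * V)] = 1.
Proof.
have : pi [~ gt, gt ^ (gu * gv)] = 1.
  by apply: presented_pi_rel; right; left; right.
by rewrite piR piJ piM.
Qed.

Let rel_ivd : (3 < n.+3)%N -> [~ T, T ^ (V ^+ 2)] = 1.
Proof.
move=> N3; have : pi [~ gt, gt ^ (gv ^+ 2)] = 1.
  by apply: presented_pi_rel; right; right.
by rewrite piR piJ piX.
Qed.

Local Notation gens := [tuple tau p d_gt1; U' p d_gt1; V' p d_gt1].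
Local Notation ev := (free_eval (tnth gens)).

Let i3P (P : 'I_3 -> Prop) : P (inord 0) -> P (inord 1) -> P (inord 2) ->
  forall i, P i.
Proof.
move=> P0 P1 P2 i; rewrite -(inord_val i).
by case: i => [[|[|[]]]].
Qed.

Let evt : ev gt = tau p d_gt1.
Proof. by rewrite free_eval_gen (tnth_nth 1) /= inordK. Qed.
Let evu : ev gu = U' p d_gt1.
Proof. by rewrite free_eval_gen (tnth_nth 1) /= inordK. Qed.
Let evv : ev gv = V' p d_gt1.
Proof. by rewrite free_eval_gen (tnth_nth 1) /= inordK. Qed.
Let evM f g : ev (f * g) = ev f * ev g. Proof. exact: gmulfM. Qed.
Let evV f : ev f^-1 = (ev f)^-1. Proof. exact: multV. Qed.
Let evJ f g : ev (f ^ g) = ev f ^ ev g. Proof. exact: multJ. Qed.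
Let evX f k : ev (f ^+ k) = ev f ^+ k. Proof. exact: multX. Qed.
Let evR f g : ev [~ f, g] = [~ ev f, ev g].
Proof. by rewrite /commg evM evV evJ. Qed.

Lemma ev_relators r : rels r -> ev r = 1.
Proof.
have ker (k : nat) (g : k.-tuple {'GL_(n.+3)(p)}) R f :
    presents R g -> R f -> free_eval (tnth g) f = 1.
  move=> RP Rf; have : nclosure R f by move=> N [_ sRN]; exact: sRN.
  by rewrite RP.
case=> [[[|]|]|].
- case=> f Rf <-; rewrite free_eval_comp -[RHS](ker _ _ _ _ R1P Rf).
  apply: eq_free_eval => i.
  by case: i => [[|[]]] // lti; rewrite !(tnth_nth 1) /= (evu, evv).
- case=> f Rf <-; rewrite free_eval_comp.
  have f1 : free_eval (tnth [tuple tau p (ltnSn 1); U' p (ltnSn 1)]) f = 1.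
    have : nclosure R2 f by move=> N [_ sRN]; exact: sRN.
    by rewrite R2P.
  rewrite -[RHS](corner_word d_gt1 f1); apply: eq_free_eval => i.
  by case: i => [[|[]]] // lti; rewrite !(tnth_nth 1) /= (evt, evu).
- case=> [[N3 ->]|[N4 ->]].
    by rewrite evR evJ evX evt evu evv matrix_rel_iiia.
  by rewrite evR evM (evM gv) evJ evV evt evu evv matrix_rel_iiib.
case=> [[[->|->]|->]|[N3 ->]].
- by rewrite evM evV evR !evJ evt evu evv matrix_rel_iva mulgV.
- by rewrite evR !evJ evt evu evv matrix_rel_ivb.
- by rewrite evR evJ evM evt evu evv matrix_rel_ivc.
by rewrite evR evJ evX evt evv matrix_rel_ivd.
Qed.

Definition presented_to_GL (x : G) : {'GL_(n.+3)(p)} := presented_lift ev x.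

Lemma presented_to_GLM : {morph presented_to_GL : x y / x * y}.
Proof. exact: (presented_liftM ev_relators). Qed.

HB.instance Definition _ :=
  isMultiplicative.Build G {'GL_(n.+3)(p)} presented_to_GL presented_to_GLM.

Let det_gens i : (\det (GLval (tnth gens i)) = 1)%R.
Proof.
move: i; apply: i3P; rewrite -(free_eval_gen (tnth gens)) (evt, evu, evv).
- exact: det_tau_mx.
- exact: det_U_mx.
exact: det_V_mx.
Qed.

Lemma det_ev f : (\det (GLval (ev f)) = 1)%R.
Proof.
apply: (free_eval_ind (P := fun A : {'GL_(n.+3)(p)} => (\det (GLval A) = 1)%R)).
- exact: det1.
- by move=> x y x1 y1; rewrite GL_MxE det_mulmx x1 y1 mulr1.
- exact: det_gens.
by move=> i; rewrite GL_VxE det_inv det_gens invr1.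
Qed.

Lemma generated_by_TUV (P : G -> Prop) : P T -> P U -> P V ->
  P 1 -> (forall x y, P x -> P y -> P (x * y)) -> (forall x, P x -> P x^-1) ->
  forall g, P g.
Proof.
move=> PT PU PV P1 PM Pi g; rewrite -[g]presented_pi_repr.
rewrite -[generic_quotient.repr g]free_word_prod free_eval_comp.
have Pg i : P ((pi \o (fun x => fgen x)) i) by move: i; exact: i3P.
by apply: free_eval_ind => // i; exact: Pi.
Qed.

Lemma presented_to_GL_gen : [/\ presented_to_GL T = tau p d_gt1,
  presented_to_GL U = U' p d_gt1 & presented_to_GL V = V' p d_gt1].
Proof.
by split; rewrite -(evt, evu, evv); exact: (presented_liftE ev_relators).
Qed.

Theorem presented_iso : group_isomorphic G [subg SLgroup n.+3 'F_p]%type.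
Proof.
have [psiT psiU psiV] := presented_to_GL_gen.
have inSL x : presented_to_GL x \in SLgroup n.+3 'F_p.
  by rewrite inE -[x]presented_pi_repr /presented_to_GL
    (presented_liftE ev_relators) det_ev.
pose h (x : G) : [subg SLgroup n.+3 'F_p]%type := subg _ (presented_to_GL x).
have hM : {morph h : x y / x * y}.
  by move=> x y; rewrite /h gmulfM subgM.
have hE x : val (h x) = presented_to_GL x by rewrite subgK.
have inj_h : injective h.
  move=> x y xy; apply/divg1_eq; apply: (phi_faithful p_pr rel1 rel2 rel_iiia
    rel_iiib rel_iva rel_ivb rel_ivc rel_ivd psiT psiU psiV generated_by_TUV).
  have psiI z : presented_to_GL z^-1 = (presented_to_GL z)^-1 by exact: multV.
  by rewrite -[LHS]/(presented_to_GL _) presented_to_GLM psiI -!hE xy mulgV.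
have surj_h y : exists x, h x = y.
  have dy : (\det (GLval (val y)) = 1)%R.
    by have := valP y; rewrite inE => /eqP.
  have [x xE] := phi_onto rel1 rel2 rel_iiia
    rel_iiib rel_iva rel_ivb rel_ivc psiT psiU psiV dy.
  by exists x; apply: val_inj; rewrite hE; exact: val_inj.
have [h' hK] := choice surj_h.
pose hm := isMultiplicative.Build G [subg SLgroup n.+3 'F_p]%type h hM.
pose hmult : {multiplicative G -> [subg SLgroup n.+3 'F_p]%type} :=
  HB.pack h hm.
exists hmult; exists h' => //= x.
by apply: inj_h; rewrite hK.
Qed.

End MainProof.

Theorem theorem5p4 (p d : nat) (p_pr : prime p) (d_gt2 : 2 < d)
    (R1 R2 : set (freeGroup 'I_2))
    (R1P : presents R1 [tuple U' p (ltnW d_gt2); V' p (ltnW d_gt2)])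
    (R2P : presents R2 [tuple tau p (ltnSn 1); U' p (ltnSn 1)]) :
  group_isomorphic (presentedGroup (relators d R1 R2)) [subg SLgroup d 'F_p].
Proof.
by case: d d_gt2 R1P => [|[|[|n]]] // d_gt2 R1P; apply: presented_iso R1P R2P.
Qed.
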